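(* Let $a_0,a_1,c_0,c_1$ be non-negative integers, $a=a_0+a_1$, $c=c_0+c_1$. Let $\beta\in\binom{[a]}{a_1}$, $\gamma,\delta\in\binom{[c]}{c_1}$ and $\nu\in\binom{[a+c]}{a_1+c_1}$. Then $$\mathrm{Trap}(\beta,\gamma,\nu,\delta)=\mathrm{Trap}(\beta,\delta,\nu,\gamma),$$ where $\mathrm{Trap}(\beta,\gamma,\nu,\delta)$ is the number of trapezoidal puzzles with SW, NW, NE, South labels $\beta,\gamma,\nu,\delta$.
   Context: Strings: $\binom{[n]}{k}$ denotes the set of binary strings (words in the symbols $0,1$) of length $n$ with exactly $k$ ones. Puzzles: work in the triangular lattice in the plane, whose unit edges make angles $0^\circ,60^\circ,120^\circ$ with the $x$-axis. Edge labels are the three symbols $0$, $1$, $10$ (where $10$ is a single symbol). A unit triangle (upward- or downward-pointing) with labeled edges is an allowed piece if its three labels read clockwise are $(0,0,0)$, $(1,1,1)$, or a cyclic rotation of $(1,0,10)$. Given a convex lattice polygon (sides along lattice directions, some sides possibly of length $0$) each of whose sides is labeled by a binary string, one symbol per unit edge, read clockwise around the polygon, a puzzle with this boundary is an assignment of labels to all unit lattice edges in the polygon which agrees with the prescribed labels on the boundary and for which every unit triangle in the polygon is an allowed piece. $\mathrm{Trap}(\beta,\gamma,\nu,\delta)$ is the number of puzzles on the trapezoid with sides, in clockwise order, SW (length $a$), NW (length $c$), NE (the long base, length $a+c$, parallel to the SW side) and South (length $c$), labeled respectively $\beta,\gamma,\nu,\delta$, each read clockwise. *)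

(* Defs.v *)
From HB Require Import structures.
From mathcomp Require Import all_boot.

Set Implicit Arguments.
Unset Strict Implicit.
Unset Printing Implicit Defensive.

Definition binary_strings (n k : nat) : {set n.-tuple bool} :=
  [set s : n.-tuple bool | count_mem true s == k].

Inductive label := L0 | L1 | L10.

Definition label_code (l : label) : option bool :=
  match l with L0 => Some false | L1 => Some true | L10 => None end.
Definition label_decode (o : option bool) : label :=
  match o with Some false => L0 | Some true => L1 | None => L10 end.
Lemma label_codeK : cancel label_code label_decode.
Proof. by case. Qed.

HB.instance Definition _ := Finite.copy label (can_type label_codeK).

Definition label_of_bit (b : bool) : label := if b then L1 else L0.

Definition allowed (l1 l2 l3 : label) : bool :=
  (l1, l2, l3) \in [:: (L0, L0, L0); (L1, L1, L1);
                       (L1, L0, L10); (L0, L10, L1); (L10, L1, L0)].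

(* (x, y) stands for the lattice point x *: u + y *: v of the plane, where u  *)
(* and v are the unit vectors at angles 0 and 60 degrees.                     *)
Definition point : Type := (nat * nat)%type.

(* An unordered unit edge is encoded by its two endpoints in a fixed order;   *)
(* only the edges edge0, edge60, edge120 (by angle with the x-axis) are used. *)
Definition edge : Type := (point * point)%type.
Definition edge0 (x y : nat) : edge := ((x, y), (x.+1, y)).
Definition edge60 (x y : nat) : edge := ((x, y), (x, y.+1)).
Definition edge120 (x y : nat) : edge := ((x.+1, y), (x, y.+1)).

(* The trapezoid has vertices (a, 0), (0, a), (0, a + c), (a + c, 0), listed  *)
(* clockwise from the South end of the SW side. It is convex, so it contains  *)
(* an edge or a triangle as soon as it contains its vertices.                 *)
Definition in_trap (a c : nat) (p : point) : bool := a <= p.1 + p.2 <= a + c.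

Definition trap_edges (a c : nat) : seq edge :=
  let r := iota 0 (a + c).+1 in
  [seq e <- [seq edge0 x y | x <- r, y <- r] ++
            [seq edge60 x y | x <- r, y <- r] ++
            [seq edge120 x y | x <- r, y <- r]
   | in_trap a c e.1 && in_trap a c e.2].

Notation labeling a c := {ffun seq_sub (trap_edges a c) -> label}.

(* The value L0 off the trapezoid is a dummy: is_trap_puzzle only looks up    *)
(* edges of the trapezoid.                                                    *)
Definition edge_label (a c : nat) (f : labeling a c) (e : edge) : label :=
  oapp f L0 (insub e).

(* Clockwise: left, right, bottom edge of an upward triangle; top, right,     *)
(* left edge of a downward one.                                               *)
Definition up_triangles_allowed (a c : nat) (f : labeling a c) : bool :=
  [forall x : 'I_(a + c).+1, forall y : 'I_(a + c).+1,
    all (in_trap a c) [:: (x : nat, y : nat); (x.+1, y : nat); (x : nat, y.+1)]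
    ==> allowed (edge_label f (edge60 x y)) (edge_label f (edge120 x y))
                (edge_label f (edge0 x y))].

Definition down_triangles_allowed (a c : nat) (f : labeling a c) : bool :=
  [forall x : 'I_(a + c).+1, forall y : 'I_(a + c).+1,
    all (in_trap a c) [:: (x.+1, y : nat); (x : nat, y.+1); (x.+1, y.+1)]
    ==> allowed (edge_label f (edge0 x y.+1)) (edge_label f (edge60 x.+1 y))
                (edge_label f (edge120 x y))].

(* Clockwise reading: SW from (a, 0) to (0, a), NW from (0, a) to (0, a + c), *)
(* NE from (0, a + c) to (a + c, 0), South from (a + c, 0) to (a, 0).         *)
Definition boundary_agrees (a c : nat) (beta : a.-tuple bool)
    (gamma : c.-tuple bool) (nu : (a + c).-tuple bool) (delta : c.-tuple bool)
    (f : labeling a c) : bool :=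
  [&& [forall i : 'I_a,
         edge_label f (edge120 (a - i.+1) i) == label_of_bit (tnth beta i)],
      [forall i : 'I_c,
         edge_label f (edge60 0 (a + i)) == label_of_bit (tnth gamma i)],
      [forall i : 'I_(a + c),
         edge_label f (edge120 i (a + c - i.+1)) == label_of_bit (tnth nu i)]
    & [forall i : 'I_c,
         edge_label f (edge0 (a + c - i.+1) 0) == label_of_bit (tnth delta i)]].

Definition is_trap_puzzle (a c : nat) (beta : a.-tuple bool)
    (gamma : c.-tuple bool) (nu : (a + c).-tuple bool) (delta : c.-tuple bool)
    (f : labeling a c) : bool :=
  [&& boundary_agrees beta gamma nu delta f, up_triangles_allowed f
    & down_triangles_allowed f].

Definition Trap (a c : nat) (beta : a.-tuple bool) (gamma : c.-tuple bool)
    (nu : (a + c).-tuple bool) (delta : c.-tuple bool) : nat :=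
  #|[set f : labeling a c | is_trap_puzzle beta gamma nu delta f]|.

(* Main.v *)
Require Import Defs.
From HB Require Import structures.
From mathcomp Require Import all_boot all_order all_algebra.
From mathcomp Require Import ring zify.

(* Cut the trapezoid into rows parallel to the South side. Reading a row from  *)
(* its bottom string to its top string, the puzzles with fixed SW and NE sides *)
(* define a matrix M(beta, nu) whose (gamma, delta) entry is the number of     *)
(* puzzles. This matrix has an equivariant deformation which commutes with the *)
(* equivariant Chevalley-Monk operator D: a "gash" 1,0 -> 0,1 entering at the  *)
(* South side moves along the strips parallel to the SW side until it reaches  *)
(* the NW side. As D is triangular with distinct diagonal entries, all the     *)
(* deformed matrices commute with each other, hence so do the M(beta, nu),     *)
(* including the matrices M(nu) of triangular puzzles (the case a = 0).        *)
(*   Puzzles with a sorted side show that M(nu) maps the sorted string to nu,  *)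
(* up to reversal. So every string is the image of the sorted one, and         *)
(* commutation yields                                                          *)
(*   Trap(beta, gamma, nu, delta) = sum_g m_g(beta, nu) Tri(gamma, delta, g)   *)
(* as well as Tri(gamma, nu, delta) = Tri(gamma, delta, nu). Together with the *)
(* rotational symmetry of Tri this makes Tri, hence Trap, symmetric in gamma   *)
(* and delta.                                                                  *)

Set Implicit Arguments.
Unset Strict Implicit.
Unset Printing Implicit Defensive.
Import GRing.Theory Num.Theory.
Local Open Scope ring_scope.

(** * Row transfer operators *)

(** A puzzle count is an entry of a matrix indexed by the South string and the NW string, and the
    theorem says that, up to reversal, this matrix is symmetric. Two facts give this: the matrices
    of all trapezoids and triangles on the same strings commute ([trapop_comm]), and a triangle
    carries the sorted string to the string on its NE side ([triop_sorted]).

    Commutation needs no bijection between glued puzzles. The local relation [monk_rowop] propagates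
    through triangles ([monk_triop]) and trapezoids ([monk_trapop]), so every deformed matrix
    commutes with the operator [monk]. On binary strings [monk] is triangular with distinct
    eigenvalues as soon as [z] is generic, and the commutant of such an operator is commutative
    ([commutant_comm]). Specialising the identity of polynomials at [z = 0] returns to honest
    puzzles, which [Trap_trapop] identifies with [trapop] at 0.

    Writing the South string as the image of the sorted one and commuting gives [Trap_factor], where
    [gamma] and [delta] enter only through a triangular count. For triangles the same formula
    exchanges two sides ([Tri_swap23]); with the rotation [Tri_rotate] this yields [Tri_swap12],
    hence [Trap_swap]. *)

Section Operators.
Variable K : comNzRingType.
Implicit Types (z eta : K) (v : bool) (n : label) (F G : seq label -> K).
Implicit Types (h : seq label).

(* An operator on strings is represented by its transpose, acting on test      *)
(* functions [F]. The row between heights [y] and [y + 1] reads the string [h] *)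
(* of its bottom edges; [n] and [v] label its leftmost and rightmost 120-edges.*)
(* A site (n, l) -> (m, o) is a downward triangle followed by an upward one:   *)
(* [n] is the left 120-edge, [l] the bottom, [m] the right 120-edge, [o] the   *)
(* top. The vertex (0,1) -> (0,1) of weight [z_i - eta] is not made of puzzle  *)
(* pieces: it is the equivariant rhombus. The equivariant parameter of the     *)
(* i-th strip is [z_i = 2^i z], whence [z + z] for the tail.                   *)
Fixpoint rowop z eta v n F h : K :=
  if h is l :: t then
    let R m o := rowop (z + z) eta v m (fun s => F (o :: s)) t in
    match n, l with
    | L0, L0 => R L0 L0
    | L0, L1 => R L1 L10 + R L10 L0 + (z - eta) * R L0 L1
    | L0, L10 => R L0 L10
    | L1, L0 => R L1 L0
    | L1, L1 => R L1 L1
    | L1, L10 => R L0 L1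
    | L10, L0 => R L0 L1
    | L10, L1 => R L10 L1
    | L10, L10 => 0
    end
  else if n == label_of_bit v then F [::] else 0.

(** [swap1] and [swap10] are the right-hand halves of a gash: the 0 that receives a 1, or a 10,
    coming from the left. A 1 must meet that 0 at once, whereas a 10 passes over 1s. *)
Definition swap1 F h : K := if h is L0 :: t then F (L1 :: t) else 0.

Fixpoint swap10 F h : K :=
  match h with
  | L0 :: t => F (L10 :: t)
  | L1 :: t => swap10 (fun s => F (L1 :: s)) t
  | _ => 0
  end.

(* Chevalley-Monk operator of a two-step flag variety, for the order           *)
(* 0 < 10 < 1 on labels: exchange a nonzero label with a later 0 when this     *)
(* removes exactly one inversion, i.e. 1,0 -> 0,1 and 10,1^k,0 -> 0,1^k,10.    *)
Fixpoint monk z F h : K :=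
  match h with
  | [::] => 0
  | L0 :: t => monk (z + z) (fun s => F (L0 :: s)) t
  | L1 :: t => monk (z + z) (fun s => F (L1 :: s)) t + z * F (L1 :: t)
               + swap1 (fun s => F (L0 :: s)) t
  | L10 :: t => monk (z + z) (fun s => F (L10 :: s)) t + z * F (L10 :: t)
               + swap10 (fun s => F (L0 :: s)) t
  end.

(* The strips end on the NW side one after the other, starting with the first; *)
(* [eta] is then the parameter of the strip which ends.                        *)
Fixpoint triop z (vs : seq bool) F h : K :=
  match vs, h with
  | [::], [::] => F [::]
  | v :: vs', l :: t =>
    let W s n :=
      rowop (z + z) z v n (triop (z + z) vs' (fun r => F (s :: r))) t in
    match l with
    | L0 => W L0 L0
    | L1 => W L1 L1 + W L0 L10
    | L10 => W L1 L0
    end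
  | _, _ => 0
  end.

Fixpoint trapop z (bs vs : seq bool) F h : K :=
  if bs is b :: bs' then
    rowop z 0 (head false vs) (label_of_bit b) (trapop z bs' (behead vs) F) h
  else triop z vs F h.

Lemma eq_rowop z eta v n F G h :
  (forall s, size s = size h -> F s = G s) ->
  rowop z eta v n F h = rowop z eta v n G h.
Proof.
elim: h z n F G => [|l t IH] z n F G FG /=; first by rewrite FG.
have E m o : rowop (z + z) eta v m (fun s => F (o :: s)) t =
             rowop (z + z) eta v m (fun s => G (o :: s)) t.
  by apply: IH => s ss; apply: FG; rewrite /= ss.
by case: n; case: l {FG IH} E => E; rewrite ?E.
Qed.

Lemma rowopD z eta v n F G h :
  rowop z eta v n (fun s => F s + G s) h =
  rowop z eta v n F h + rowop z eta v n G h.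
Proof.
elim: h z n F G => [|l t IH] z n F G /=; first by case: eqP; rewrite ?addr0.
by case: n; case: l; rewrite ?IH ?addr0 //; ring.
Qed.

Lemma rowopZ z eta v n a F h :
  rowop z eta v n (fun s => a * F s) h = a * rowop z eta v n F h.
Proof.
elim: h z n F => [|l t IH] z n F /=; first by case: eqP; rewrite ?mulr0.
by case: n; case: l; rewrite ?IH ?mulr0 //; ring.
Qed.

Lemma rowop0 z eta v n h : rowop z eta v n (fun=> 0) h = 0.
Proof.
elim: h z n => [|l t IH] z n /=; first by case: eqP.
by case: n; case: l; rewrite ?IH //; ring.
Qed.

(** Binary strings suffice because [triop] only ever puts 0 or 1 on the NW side. *)
Lemma eq_triop z vs F G h :
  (forall s : seq bool, size s = size h ->
     F (map label_of_bit s) = G (map label_of_bit s)) ->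
  triop z vs F h = triop z vs G h.
Proof.
elim: vs z F G h => [|v vs IH] z F G [|l t] FG //=; first exact: (FG [::]).
have E n b : rowop (z + z) z v n
               (triop (z + z) vs (fun r => F (label_of_bit b :: r))) t =
             rowop (z + z) z v n
               (triop (z + z) vs (fun r => G (label_of_bit b :: r))) t.
  apply: eq_rowop => s ss; apply: IH => r rs.
  by apply: (FG (b :: r)); rewrite /= rs ss.
by case: l {FG}; rewrite -?[L1]/(label_of_bit true) -?[L0]/(label_of_bit false) !E.
Qed.

Lemma triopD z vs F G h :
  triop z vs (fun s => F s + G s) h = triop z vs F h + triop z vs G h.
Proof.
elim: vs z F G h => [|v vs IH] z F G [|l t] //=; rewrite ?addr0 //.
have E n o : rowop (z + z) z v n
               (triop (z + z) vs (fun r => F (o :: r) + G (o :: r))) t =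
  rowop (z + z) z v n (triop (z + z) vs (fun r => F (o :: r))) t +
  rowop (z + z) z v n (triop (z + z) vs (fun r => G (o :: r))) t.
  by rewrite -rowopD; apply: eq_rowop => s _; apply: IH.
by case: l; rewrite !E //; ring.
Qed.

Lemma triopZ z vs a F h :
  triop z vs (fun s => a * F s) h = a * triop z vs F h.
Proof.
elim: vs z F h => [|v vs IH] z F [|l t] //=; rewrite ?mulr0 //.
have E n o : rowop (z + z) z v n
               (triop (z + z) vs (fun r => a * F (o :: r))) t =
  a * rowop (z + z) z v n (triop (z + z) vs (fun r => F (o :: r))) t.
  by rewrite -rowopZ; apply: eq_rowop => s _; apply: IH.
by case: l; rewrite !E //; ring.
Qed.

Lemma eq_monk z F G h :
  (forall s, size s = size h -> F s = G s) -> monk z F h = monk z G h.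
Proof.
have S10 t F' G' : (forall s, size s = size t -> F' s = G' s) ->
    swap10 F' t = swap10 G' t.
  elim: t F' G' => [|[] t IH] F' G' FG //=; first by rewrite FG.
  by apply: IH => s ss; apply: FG; rewrite /= ss.
elim: h z F G => [|l t IH] z F G FG //=.
have E o : (forall s, size s = size t -> F (o :: s) = G (o :: s)).
  by move=> s ss; apply: FG; rewrite /= ss.
have E1 : swap1 (fun s => F (L0 :: s)) t = swap1 (fun s => G (L0 :: s)) t.
  by case: t E {IH FG} => [|[] t] //= E; rewrite E.
by case: l FG => FG; rewrite ?E1 ?(IH _ _ _ (E _)) ?(S10 _ _ _ (E _)) ?FG.
Qed.

(** First of the local moves of a gash through a row: a leading top 0 turned into 1 is traded for a
    left edge turned from 0 into 10. *)
Lemma rowop_swap1_L0 z eta v F h :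
  rowop z eta v L0 (swap1 F) h = rowop z eta v L10 F h.
Proof.
case: h => [|[] t] /=; rewrite ?rowop0 ?add0r ?mulr0 ?addr0 //; by case: v.
Qed.

Lemma rowop_swap1_L1 z eta v F h :
  rowop z eta v L1 (swap1 F) h = swap1 (rowop z eta v L1 F) h.
Proof. by case: h => [|[] t] /=; rewrite ?rowop0 //; case: eqP. Qed.

Lemma rowop_swap1_L10 z eta v F h : rowop z eta v L10 (swap1 F) h = 0.
Proof. by case: h => [|[] t] /=; rewrite ?rowop0 //; case: v. Qed.

(** The bottom counterpart: leading 1s are copied with left edge 1 as well as 10, and at the first 0
    the sites (1, 10) and (10, 0) behave alike. *)
Lemma swap10_rowop_L1 z eta v F h :
  swap10 (rowop z eta v L1 F) h = rowop z eta v L10 F h.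
Proof. by elim: h z F => [|[] t IH] z F //=; case: v. Qed.

Lemma swap10_rowop_L10 z eta v F h : swap10 (rowop z eta v L10 F) h = 0.
Proof. by elim: h z F => [|[] t IH] z F //=. Qed.

Lemma swap10D F G h :
  swap10 (fun s => F s + G s) h = swap10 F h + swap10 G h.
Proof. by elim: h F G => [|[] t IH] F G //=; rewrite ?IH ?addr0. Qed.

Lemma swap10Z a F h : swap10 (fun s => a * F s) h = a * swap10 F h.
Proof. by elim: h F => [|[] t IH] F //=; rewrite ?IH ?mulr0. Qed.

(** At a leading 1 the gash matches two different branches of the site: [R L10 L0] with its top
    changed, and [R L1 L10] with the bottom of its tail changed. *)
Lemma rowop_swap10_L0 z eta v F h :
  rowop z eta v L0 (swap10 F) h = swap10 (rowop z eta v L0 F) h.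
Proof.
elim: h z F => [|[] t IH] z F //=; first by case: v.
- rewrite !swap10D swap10Z swap10_rowop_L1 swap10_rowop_L10 addr0 IH.
  by rewrite rowop0 add0r.
- by rewrite rowop0.
Qed.

Lemma swap1D F G h : swap1 (fun s => F s + G s) h = swap1 F h + swap1 G h.
Proof. by case: h => [|[] t] //=; rewrite addr0. Qed.

Lemma swap1Z a F h : swap1 (fun s => a * F s) h = a * swap1 F h.
Proof. by case: h => [|[] t] //=; rewrite mulr0. Qed.

Lemma monkD z F G h : monk z (fun s => F s + G s) h = monk z F h + monk z G h.
Proof.
elim: h z F G => [|[] t IH] z F G /=; rewrite ?addr0 ?IH ?swap1D ?swap10D //.
all: ring.
Qed.

Lemma monkZ z a F h : monk z (fun s => a * F s) h = a * monk z F h.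
Proof.
elim: h z F => [|[] t IH] z F /=; rewrite ?mulr0 ?IH ?swap1Z ?swap10Z //.
all: ring.
Qed.

Lemma monk0 z h : monk z (fun=> 0) h = 0.
Proof.
transitivity (monk z (fun=> 0 * 0 : K) h); last by rewrite monkZ mul0r.
by apply: eq_monk => s _; rewrite mul0r.
Qed.

(** A left edge 0 or 1 lets no gash out, so the row commutes with [monk]. A left edge 10 can be
    opened in two ways: it becomes 0 while a bottom 0 becomes 1, or it becomes 1 while a top 0
    becomes 10. The term in [eta] balances the weights [z - eta]. *)
Lemma monk_rowop z eta v F h :
  [/\ monk z (rowop z eta v L0 F) h = rowop z eta v L0 (monk z F) h,
      monk z (rowop z eta v L1 F) h = rowop z eta v L1 (monk z F) h
    & monk z (rowop z eta v L10 F) h + swap1 (rowop z eta v L0 F) h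
        + eta * rowop z eta v L10 F h
      = rowop z eta v L10 (monk z F) h + rowop z eta v L1 (swap10 F) h].
Proof.
elim: h z F => [|l t IH] z F.
  by case: v => /=; split=> //; ring.
have X0 G : monk (z + z) (rowop (z + z) eta v L0 G) t =
            rowop (z + z) eta v L0 (monk (z + z) G) t.
  by have [] := IH (z + z) G.
have X1 G : monk (z + z) (rowop (z + z) eta v L1 G) t =
            rowop (z + z) eta v L1 (monk (z + z) G) t.
  by have [] := IH (z + z) G.
have X10 G : monk (z + z) (rowop (z + z) eta v L10 G) t =
    rowop (z + z) eta v L10 (monk (z + z) G) t
    + rowop (z + z) eta v L1 (swap10 G) t
    - swap1 (rowop (z + z) eta v L0 G) t
    - eta * rowop (z + z) eta v L10 G t.
  have [_ _ E] := IH (z + z) G.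
  by rewrite -E; ring.
have Q0 G : rowop (z + z) eta v L0 (swap1 G) t =
            rowop (z + z) eta v L10 G t by exact: rowop_swap1_L0.
have Q1 G : rowop (z + z) eta v L1 (swap1 G) t =
   swap1 (rowop (z + z) eta v L1 G) t by exact: rowop_swap1_L1.
have Q10 G : rowop (z + z) eta v L10 (swap1 G) t = 0
  by exact: rowop_swap1_L10.
have P1 G : swap10 (rowop (z + z) eta v L1 G) t =
            rowop (z + z) eta v L10 G t by exact: swap10_rowop_L1.
have P10 G : swap10 (rowop (z + z) eta v L10 G) t = 0
  by exact: swap10_rowop_L10.
have P0 G : rowop (z + z) eta v L0 (swap10 G) t =
  swap10 (rowop (z + z) eta v L0 G) t by exact: rowop_swap10_L0.
split; case: l => /=;
  rewrite ?(monkD, monkZ, swap10D, swap10Z, swap1D, swap1Z, rowopD, rowopZ,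
   X0, X1, X10, Q0, Q1, Q10, P1, P10, P0, rowop0);
  by rewrite ?monk0; ring.
Qed.

(** A gash that enters a triangle from below by turning 0 into 10 leaves through the NW side by
    turning a leading 0 into 1. *)
Lemma swap10_triop z vs F h : swap10 (triop z vs F) h = triop z vs (swap1 F) h.
Proof.
have Q1 vs' G t : triop (z + z) vs' (fun r => swap1 G (L1 :: r)) t = 0.
  transitivity (triop (z + z) vs' (fun=> 0 * 0 : K) t).
    2: by rewrite triopZ mul0r.
  by apply: eq_triop => s _; rewrite mul0r.
case: vs => [|v vs]; first by case: h => [|[] t] //=; elim: t => [|[]].
case: h => [|l t] //=.
have R1 n : rowop (z + z) z v n
    (triop (z + z) vs (fun r => swap1 F (L1 :: r))) t = 0.
  by rewrite (eq_rowop _ _ _ _ (G := fun=> 0)) ?rowop0 // => s _; rewrite Q1.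
case: l; rewrite ?R1 ?add0r //=.
by rewrite swap10D swap10_rowop_L1 swap10_rowop_L10 addr0.
Qed.

(** Above a first bottom label 1 the row may start with 10. The extra terms of [monk_rowop] are then
    what this first strip contributes: its diagonal weight, which forces [eta = z], and the gashes
    that begin at its bottom and at its NW end. *)
Lemma monk_triop z vs F h :
  size vs = size h -> monk z (triop z vs F) h = triop z vs (monk z F) h.
Proof.
elim: vs z F h => [|v vs IH] z F [|l t] //= [st].
have C s n : rowop (z + z) z v n (monk (z + z)
      (triop (z + z) vs (fun r => F (s :: r)))) t =
    rowop (z + z) z v n
      (triop (z + z) vs (monk (z + z) (fun r => F (s :: r)))) t.
  by apply: eq_rowop => o so; apply: IH; rewrite so.
have X n s := @monk_rowop (z + z) z v
  (triop (z + z) vs (fun r => F (s :: r))) t.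
(* The last term is the gash moving the leading 1 of the NW string, pushed down through the smaller
   triangle by [swap10_triop]. *)
have A n : rowop (z + z) z v n (triop (z + z) vs (fun r => monk z F (L1 :: r))) t
  = rowop (z + z) z v n
      (triop (z + z) vs (monk (z + z) (fun r => F (L1 :: r)))) t
  + z * rowop (z + z) z v n (triop (z + z) vs (fun r => F (L1 :: r))) t
  + rowop (z + z) z v n (swap10 (triop (z + z) vs (fun r => F (L0 :: r)))) t.
  rewrite -rowopZ -!rowopD; apply: eq_rowop => o _.
  by rewrite swap10_triop -triopZ -!triopD.
case: l => /=.
- by have [-> _ _] := X L0 L0; rewrite C.
- have [_ X1 _] := X L0 L1; have [_ _ X10] := X L0 L0.
  rewrite monkD X1 A !C.
  (* The third identity solved for its [monk] term; its [eta] part cancels the diagonal weight on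
     the branch starting with 10. *)
  have -> := canRL (addrK _) (canRL (addrK _) X10).
  by rewrite C; ring.
- have [X0 _ _] := X L0 L1.
  by rewrite X0 A C rowop_swap10_L0.
Qed.

(** The SW labels are 0 or 1, so a gash cannot leave before the triangle on top, and the first two
    identities of [monk_rowop] suffice for the rows below it. *)
Lemma monk_trapop z bs vs F h : size vs = (size bs + size h)%N ->
  monk z (trapop z bs vs F) h = trapop z bs vs (monk z F) h.
Proof.
elim: bs vs F h => [|b bs IH] vs F h /=; first exact: monk_triop.
case: vs => [|v vs] //= [sz].
have [X0 X1 _] := @monk_rowop z 0 v (trapop z bs vs F) h.
transitivity (rowop z 0 v (label_of_bit b) (monk z (trapop z bs vs F)) h).
  by case: b.
by apply: eq_rowop => s ss; apply: IH; rewrite ss.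
Qed.

End Operators.

(** * The commutant of a triangular operator with simple spectrum *)

Section Commutant.
Variables (K : idomainType) (S : finType) (r : S -> nat) (D : S -> S -> K).
Hypothesis D_triangular : forall h g, D h g != 0 -> h = g \/ (r h < r g)%N.
Hypothesis D_diag_inj : forall h g, D h h = D g g -> h = g.

Definition kmul (X Y : S -> S -> K) h g := \sum_f X h f * Y f g.

Lemma kmulA X Y Z h g : kmul X (kmul Y Z) h g = kmul (kmul X Y) Z h g.
Proof.
rewrite /kmul; under eq_bigr do rewrite mulr_sumr.
rewrite exchange_big; apply: eq_bigr => f _; rewrite mulr_suml.
by apply: eq_bigr => e _; rewrite mulrA.
Qed.

Definition commutes X := forall h g, kmul D X h g = kmul X D h g.

(** In the entry at [(h, g)] of DX = XD only diagonal terms of [D] survive, which leaves (D h h - D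
    g g) X h g = 0. *)
Lemma commutes_entry X h g : commutes X ->
  (forall f, D h f != 0 -> f != h -> X f g = 0) ->
  (forall f, D f g != 0 -> f != g -> X h f = 0) ->
  h != g -> X h g = 0.
Proof.
move=> cX Xl Xr hg; have := cX h g; rewrite /kmul.
have -> : \sum_f D h f * X f g = D h h * X h g.
  rewrite (bigD1 h) //= big1 ?addr0 // => f fh.
  have [->|Df] := eqVneq (D h f) 0; first by rewrite mul0r.
  by rewrite (Xl f) ?mulr0.
have -> : \sum_f X h f * D f g = X h g * D g g.
  rewrite (bigD1 g) //= big1 ?addr0 // => f fg.
  have [->|Df] := eqVneq (D f g) 0; first by rewrite mulr0.
  by rewrite (Xr f) ?mul0r.
move/eqP; rewrite [X in _ == X]mulrC -subr_eq0 -mulrBl mulf_eq0 => /orP[].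
  by rewrite subr_eq0 => /eqP/D_diag_inj E; rewrite E eqxx in hg.
by move/eqP.
Qed.

(** The equation at an entry on the wrong side of the diagonal involves only entries of larger row
    rank or smaller column rank, still on the wrong side. The bound [N] on ranks makes this a
    well-founded induction. *)
Lemma commutes_triangular X h g : commutes X ->
  X h g != 0 -> h = g \/ (r h < r g)%N.
Proof.
move=> cX; have [->|hg] := eqVneq h g; first by left.
case: (ltnP (r h) (r g)) => [|rgh]; first by right.
case/eqP; pose N := (\max_f r f)%N.
have rN f : (r f <= N)%N by apply: leq_bigmax.
have [m] := ubnP ((N - r h) + r g).
elim: m h g hg rgh => // m IH h g hg rgh lt_m.
apply: (commutes_entry cX) => // f /D_triangular[->|rf]; rewrite ?eqxx // => nf.
  have := rN f; have := rN h => rNh rNf.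
  apply: IH; last lia; last lia.
  by apply: contraTneq rf => ->; lia.
apply: IH; last lia; last lia.
by apply: contraTneq rf => <-; lia.
Qed.

(** An element of the commutant is determined by its diagonal: the equation at an entry above it
    involves only entries with a smaller rank gap. *)
Lemma commutes_diag0 X : commutes X -> (forall h, X h h = 0) ->
  forall h g, X h g = 0.
Proof.
move=> cX X0 h g; have [m] := ubnP (r g - r h).
elim: m h g => // m IH h g lt_m.
have [->//|hg] := eqVneq h g.
have [//|nz] := eqVneq (X h g) 0.
have [/eqP|rhg] := commutes_triangular cX nz; first by rewrite (negPf hg).
by apply: (commutes_entry cX) => // f /D_triangular[->|rf];
  rewrite ?eqxx // => _; apply: IH; lia.
Qed.

(** The commutator of [X] and [Y] again commutes with [D], and its diagonal vanishes because both
    are triangular. *)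
Lemma commutant_comm X Y : commutes X -> commutes Y ->
  forall h g, kmul X Y h g = kmul Y X h g.
Proof.
move=> cX cY h g; apply/eqP; rewrite -subr_eq0; apply/eqP.
pose C h g := kmul X Y h g - kmul Y X h g.
have kmulBr A (Z Z' : S -> S -> K) i j :
    kmul A (fun a b => Z a b - Z' a b) i j = kmul A Z i j - kmul A Z' i j.
  by rewrite /kmul -sumrB; apply: eq_bigr => f _; rewrite mulrBr.
have kmulBl A (Z Z' : S -> S -> K) i j :
    kmul (fun a b => Z a b - Z' a b) A i j = kmul Z A i j - kmul Z' A i j.
  by rewrite /kmul -sumrB; apply: eq_bigr => f _; rewrite mulrBl.
have eq_kmul A A' B B' i j : (forall a b, A a b = A' a b) ->
    (forall a b, B a b = B' a b) -> kmul A B i j = kmul A' B' i j.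
  by move=> EA EB; apply: eq_bigr => f _; rewrite EA EB.
have cXY A B : commutes A -> commutes B -> commutes (kmul A B).
  move=> cA cB i j; rewrite kmulA (eq_kmul _ (kmul A D) _ B) // -kmulA.
  by rewrite (eq_kmul _ A _ (kmul B D)) // kmulA.
apply: (@commutes_diag0 C) => [i j|i].
  by rewrite kmulBr kmulBl !(cXY _ _ _ _) //.
rewrite /C /kmul -sumrB big1 // => f _.
have [->|fi] := eqVneq f i; first by rewrite mulrC subrr.
(* An off-diagonal path from [i] to [f] and back would need r i < r f < r i. *)
have Z A B : commutes A -> commutes B -> A i f * B f i = 0.
  move=> cA cB; apply/eqP; rewrite mulf_eq0; apply/negPn/negP.
  rewrite negb_or => /andP[/(commutes_triangular cA) EA].
  move/(commutes_triangular cB) => EB.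
  case: EA => [E|lt1]; first by rewrite E eqxx in fi.
  by case: EB => [E|lt2]; [rewrite E eqxx in fi | lia].
by rewrite !Z ?subrr.
Qed.

End Commutant.

(** * Matrices on binary strings and the spectrum of the Monk operator *)

Definition bit_labels (s : seq bool) : seq label := map label_of_bit s.

Lemma bit_labels_inj : injective bit_labels.
Proof. by apply: inj_map => - [] []. Qed.

Section Expansion.
Variable K : comNzRingType.
Implicit Types (z : K) (F G : seq label -> K).

Definition indicator (g : seq bool) : seq label -> K := fun s => (s == bit_labels g)%:R.

Lemma indicator_bit_labels (g s : seq bool) : indicator g (bit_labels s) = (s == g)%:R.
Proof. by rewrite /indicator (inj_eq bit_labels_inj). Qed.

Lemma eq_trapop z bs vs F G h :
  (forall s : seq bool, size s = size h -> F (bit_labels s) = G (bit_labels s)) ->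
  trapop z bs vs F h = trapop z bs vs G h.
Proof.
elim: bs vs h => [|b bs IH] vs h FG /=; first exact: eq_triop.
by apply: eq_rowop => s ss; apply: IH => s' ss'; apply: FG; rewrite ss'.
Qed.

Lemma trapopD z bs vs F G h :
  trapop z bs vs (fun s => F s + G s) h = trapop z bs vs F h + trapop z bs vs G h.
Proof.
elim: bs vs h => [|b bs IH] vs h /=; first exact: triopD.
by rewrite -rowopD; apply: eq_rowop => s _; apply: IH.
Qed.

Lemma trapopZ z bs vs a F h :
  trapop z bs vs (fun s => a * F s) h = a * trapop z bs vs F h.
Proof.
elim: bs vs h => [|b bs IH] vs h /=; first exact: triopZ.
by rewrite -rowopZ; apply: eq_rowop => s _; apply: IH.
Qed.

(** On a binary string the only moves are 1,0 -> 0,1, so the label 10 never appears. *)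
Lemma eq_monk_bit_labels z F G (h : seq bool) :
  (forall s : seq bool, size s = size h -> F (bit_labels s) = G (bit_labels s)) ->
  monk z F (bit_labels h) = monk z G (bit_labels h).
Proof.
elim: h z F G => [|b t IH] z F G FG //=.
have E o : monk (z + z) (fun s => F (label_of_bit o :: s)) (bit_labels t) =
           monk (z + z) (fun s => G (label_of_bit o :: s)) (bit_labels t).
  by apply: IH => s ss; apply: (FG (o :: s)); rewrite /= ss.
case: b FG => FG; rewrite ?(E false) //= (E true) (FG (true :: t)) //.
congr (_ + _); case: t FG {IH E} => [|[] t] //= FG.
by apply: (FG [:: false, true & t]).
Qed.

(** Turns the operators on test functions into matrices, to which the commutant argument applies. *)
Lemma functional_expand c (L : (seq label -> K) -> K) :
  (forall F G, (forall s : c.-tuple bool, F (bit_labels s) = G (bit_labels s)) -> L F = L G) ->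
  (forall F G, L (fun s => F s + G s) = L F + L G) ->
  (forall a F, L (fun s => a * F s) = a * L F) ->
  forall F, L F = \sum_(g : c.-tuple bool) L (indicator g) * F (bit_labels g).
Proof.
move=> Le LD LZ F.
have L0 : L (fun=> 0) = 0.
  transitivity (L (fun=> 0 * 0)); last by rewrite LZ mul0r.
  by apply: Le => s; rewrite mulr0.
have LS (r : seq (c.-tuple bool)) :
    L (fun s => \sum_(g <- r) F (bit_labels g) * indicator g s) =
    \sum_(g <- r) L (indicator g) * F (bit_labels g).
  elim: r => [|g r IH]; first by rewrite big_nil -L0; apply: Le => s; rewrite big_nil.
  rewrite big_cons -IH mulrC -LZ -LD; apply: Le => s.
  by rewrite big_cons.
rewrite -LS; apply: Le => s.
rewrite (bigD1 s) //= big1 ?addr0 => [|g gs].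
  by rewrite indicator_bit_labels eqxx mulr1.
by rewrite indicator_bit_labels; case: eqP => [/val_inj E|]; rewrite ?E ?eqxx ?mulr0 // in gs *.
Qed.

Lemma trapop_expand z bs vs c F (h : c.-tuple bool) :
  trapop z bs vs F (bit_labels h) =
  \sum_(g : c.-tuple bool) trapop z bs vs (indicator g) (bit_labels h) * F (bit_labels g).
Proof.
apply: (functional_expand (L := fun F => trapop z bs vs F (bit_labels h))) => [F' G FG|*|*].
- apply: eq_trapop => s; rewrite size_map size_tuple => /eqP ss.
  exact: (FG (Tuple ss)).
- exact: trapopD.
- exact: trapopZ.
Qed.

Lemma monk_expand z c F (h : c.-tuple bool) :
  monk z F (bit_labels h) =
  \sum_(g : c.-tuple bool) monk z (indicator g) (bit_labels h) * F (bit_labels g).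
Proof.
apply: (functional_expand (L := fun F => monk z F (bit_labels h))) => [F' G FG|*|*].
- apply: eq_monk_bit_labels => s; rewrite size_tuple => /eqP ss.
  exact: (FG (Tuple ss)).
- exact: monkD.
- exact: monkZ.
Qed.

(* With [z_i = 2^i z], the eigenvalues of [monk] are [z * binary h].           *)
Fixpoint binary (s : seq bool) : nat :=
  if s is b :: t then (b + (binary t).*2)%N else 0.

Lemma binary_inj (s t : seq bool) : size s = size t -> binary s = binary t -> s = t.
Proof.
elim: s t => [|b s IH] [|b' t] //= [st].
by case: b; case: b' => E; try (by lia); rewrite (IH t) //; lia.
Qed.

(** Bits come with the lowest weight first, so a move 1,0 -> 0,1 increases [binary]; only the
    diagonal weights remain. *)
Lemma monk_triangular z F (h : seq bool) :
  (forall g : seq bool, size g = size h -> (binary h < binary g)%N ->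
     F (bit_labels g) = 0) ->
  monk z F (bit_labels h) = z * (binary h)%:R * F (bit_labels h).
Proof.
elim: h z F => [|b t IH] z F F0 /=; first by rewrite mulr0 mul0r.
have I : monk (z + z) (fun s => F (label_of_bit b :: s)) (bit_labels t) =
  (z + z) * (binary t)%:R * F (label_of_bit b :: bit_labels t).
  apply: IH => g sg lt; apply: (F0 (b :: g)); rewrite /= ?sg // .
  by case: b {F0}; lia.
case: b I F0 => /= -> F0.
  rewrite -muln2 natrD natrM.
  have -> : swap1 (fun s => F (L0 :: s)) (bit_labels t) = 0.
    case: t F0 {IH} => [|[] t] //= F0.
    by apply: (F0 [:: false, true & t]) => //=; lia.
  by ring.
by rewrite add0n -muln2 natrM; ring.
Qed.

Lemma monk_indicator_neq0 z (h g : seq bool) : size h = size g ->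
  monk z (indicator g) (bit_labels h) != 0 -> h = g \/ (binary h < binary g)%N.
Proof.
move=> hg; case: (ltnP (binary h) (binary g)) => [|le]; first by right.
rewrite monk_triangular => [|s ss lt].
  rewrite indicator_bit_labels; case: (h =P g) => [->|_]; first by left.
  by rewrite mulr0 eqxx.
by rewrite indicator_bit_labels; case: eqP => // E; rewrite E in lt; lia.
Qed.

Lemma monk_indicator_diag z (h : seq bool) :
  monk z (indicator h) (bit_labels h) = z * (binary h)%:R.
Proof.
rewrite monk_triangular => [|s ss lt].
  by rewrite indicator_bit_labels eqxx mulr1.
by rewrite indicator_bit_labels; case: eqP => // E; rewrite E in lt; lia.
Qed.

End Expansion.

(** * Specialisation of the equivariant parameter *)

Section Morphism.
Variables (K K' : comNzRingType) (phi : {rmorphism K -> K'}).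

Lemma rowop_morph z eta v n F h :
  phi (rowop z eta v n F h) = rowop (phi z) (phi eta) v n (phi \o F) h.
Proof.
elim: h z n F => [|l t IH] z n F /=; first by case: eqP; rewrite ?rmorph0.
by case: n; case: l; rewrite ?rmorphD ?rmorphM ?rmorphB ?IH ?rmorphD ?rmorph0.
Qed.

Lemma triop_morph z vs F h :
  phi (triop z vs F h) = triop (phi z) vs (phi \o F) h.
Proof.
elim: vs z F h => [|v vs IH] z F [|l t] /=; rewrite ?rmorph0 //.
by case: l; rewrite ?rmorphD ?rowop_morph rmorphD; try congr (_ + _);
  apply: eq_rowop => s _; rewrite /= IH rmorphD.
Qed.

Lemma trapop_morph z bs vs F h :
  phi (trapop z bs vs F h) = trapop (phi z) bs vs (phi \o F) h.
Proof.
elim: bs vs h => [|b bs IH] vs h /=; first exact: triop_morph.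
rewrite rowop_morph rmorph0; apply: eq_rowop => s _; exact: IH.
Qed.

End Morphism.

(** * Commutation of the transfer matrices *)

Section Commutation.
Variable c : nat.

Definition trapmx (K : comNzRingType) (z : K) bs vs (h g : c.-tuple bool) : K :=
  trapop z bs vs (indicator K g) (bit_labels h).

Lemma trapmx_commutes (K : comNzRingType) (z : K) bs vs (h g : c.-tuple bool) :
  size vs = (size bs + c)%N ->
  \sum_f monk z (indicator K (tval f)) (bit_labels h) * trapmx z bs vs f g =
  \sum_f trapmx z bs vs h f * monk z (indicator K g) (bit_labels f).
Proof.
move=> sz; rewrite -(monk_expand z (trapop z bs vs (indicator K g))).
rewrite monk_trapop; last by rewrite size_map size_tuple.
exact: trapop_expand.
Qed.

(** Over the domain [{poly int}] the eigenvalues ['X] times [binary h] are pairwise distinct, so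
    [commutant_comm] applies. *)
Lemma trapmx_comm_generic bs1 vs1 bs2 vs2 (h g : c.-tuple bool) :
  size vs1 = (size bs1 + c)%N -> size vs2 = (size bs2 + c)%N ->
  \sum_f trapmx ('X : {poly int}) bs1 vs1 h f * trapmx 'X bs2 vs2 f g =
  \sum_f trapmx 'X bs2 vs2 h f * trapmx 'X bs1 vs1 f g.
Proof.
move=> sz1 sz2.
apply: (@commutant_comm _ _ (fun h : c.-tuple bool => binary h)
  (fun h g : c.-tuple bool => monk 'X (indicator _ g) (bit_labels h))) => [{}h {}g|{}h {}g|{}h {}g|{}h {}g].
- by case/monk_indicator_neq0 => [|/val_inj|]; rewrite ?size_tuple; auto.
- rewrite !monk_indicator_diag => /(mulfI (negbT (polyX_eq0 _)))/eqP.
  rewrite -!polyC_natr (inj_eq (@polyC_inj _)) eqr_nat => /eqP/binary_inj E.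
  by apply/val_inj/E; rewrite !size_tuple.
- exact: trapmx_commutes.
- exact: trapmx_commutes.
Qed.

Lemma trapmx_X0 bs vs (h g : c.-tuple bool) :
  trapmx (0 : int) bs vs h g = horner_eval 0 (trapmx 'X bs vs h g).
Proof.
rewrite trapop_morph /= /horner_eval hornerX; apply: eq_trapop => s _.
by rewrite /= !indicator_bit_labels /horner_eval -polyC_natr hornerC.
Qed.

(* At [z = 0] the equivariant vertex disappears, but the spectrum is simple only for generic [z]. *)
Lemma trapop_comm bs1 vs1 bs2 vs2 F (h : c.-tuple bool) :
  size vs1 = (size bs1 + c)%N -> size vs2 = (size bs2 + c)%N ->
  trapop (0 : int) bs1 vs1 (trapop 0 bs2 vs2 F) (bit_labels h) =
  trapop 0 bs2 vs2 (trapop 0 bs1 vs1 F) (bit_labels h).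
Proof.
move=> sz1 sz2.
have E bs vs bs' vs' :
    trapop (0 : int) bs vs (trapop 0 bs' vs' F) (bit_labels h) =
    \sum_g (\sum_f trapmx (0 : int) bs vs h f * trapmx 0 bs' vs' f g) *
      F (bit_labels (tval g)).
  rewrite trapop_expand; under [RHS]eq_bigr do rewrite mulr_suml.
  rewrite exchange_big /=; apply: eq_bigr => f _.
  rewrite (trapop_expand _ bs' vs' F) mulr_sumr; apply: eq_bigr => g _.
  by rewrite mulrA.
rewrite !E; apply: eq_bigr => g _; congr (_ * _).
have M bs vs bs' vs' :
    \sum_f trapmx (0 : int) bs vs h f * trapmx 0 bs' vs' f g =
    horner_eval 0 (\sum_f trapmx 'X bs vs h f * trapmx 'X bs' vs' f g).
  rewrite rmorph_sum; apply: eq_bigr => f _.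
  by rewrite !trapmx_X0 -rmorphM.
by rewrite !M trapmx_comm_generic.
Qed.

End Commutation.

(** * Puzzles with a sorted side *)

Section Identity.
Variable K : comNzRingType.
Implicit Types (F : seq label -> K).

Definition sorted_string i j := nseq i true ++ nseq j false.

Lemma rowop_ones z eta v F (h : seq bool) :
  rowop z eta v L1 F (bit_labels h) = if v then F (bit_labels h) else 0.
Proof.
elim: h z F => [|b t IH] z F /=; first by case: v.
by case: b => /=; rewrite IH.
Qed.

Lemma rowop_zeros z eta v F j :
  rowop z eta v L0 F (bit_labels (nseq j false)) =
  if v then 0 else F (bit_labels (nseq j false)).
Proof. by elim: j z F => [|j IH] z F /=; [case: v | exact: IH]. Qed.

(** The left 10 travels above the 1s, turns the first 0 into a 1 and continues as 0, so the row must
    end with 0. *)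
Lemma rowop_sorted z eta v F i j :
  rowop z eta v L10 F (bit_labels (sorted_string i j)) =
  if ~~ v && (0 < j)%N then F (bit_labels (sorted_string i.+1 j.-1)) else 0.
Proof.
elim: i z F => [|i IH] z F /=; last exact: IH.
by case: j => [|j] /=; [case: v | rewrite rowop_zeros; case: v].
Qed.

(* The puzzles with one sorted side: multiplication by the identity class.     *)
Lemma triop_sorted z vs F i j :
  size vs = (i + j)%N -> count_mem true vs = i ->
  triop z vs F (bit_labels (sorted_string i j)) = F (bit_labels vs).
Proof.
elim: vs z F i j => [|v vs IH] z F i j /=; first by case: i => //; case: j.
case: i => [|i] sz cnt.
  case: j sz => // j [sz]; rewrite /= rowop_zeros.
  case: v cnt => // cnt.
  by rewrite -[bit_labels (nseq j _)]/(bit_labels (sorted_string 0 j)) IH.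
have {}sz : size vs = (i + j)%N by move: sz; rewrite addSn => -[].
rewrite /= rowop_ones rowop_sorted.
case: v cnt => /= cnt; first by rewrite addr0 IH //; case: cnt.
case: j sz => [|j] sz /=.
  by move: cnt (count_size (pred1 true) vs); rewrite add0n sz => ->; lia.
by rewrite add0r (IH _ (fun r => F (L0 :: r)) i.+1 j) //; lia.
Qed.

End Identity.

(** * Labelings of a trapezoid as row transfers *)

Definition upd (f : edge -> label) e l : edge -> label :=
  fun e' => if e' == e then l else f e'.

(** Labels are summed edge by edge over the list, starting from [f], so that a count can be peeled
    off one site at a time. *)
Fixpoint count_ext (es : seq edge) (P : (edge -> label) -> bool) f : int :=
  if es is e :: es' then \sum_(l : label) count_ext es' P (upd f e l)
  else (P f)%:R.

Lemma upd_eq f e l : upd f e l e = l.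
Proof. by rewrite /upd eqxx. Qed.

Lemma upd_neq f e l e' : e' != e -> upd f e l e' = f e'.
Proof. by rewrite /upd => /negPf->. Qed.

Lemma eq_count_ext es P P' f :
  (forall g, (forall e, e \notin es -> g e = f e) -> P g = P' g) ->
  count_ext es P f = count_ext es P' f.
Proof.
elim: es f => [|e es IH] f PP' /=; first by rewrite PP'.
apply: eq_bigr => l _; apply: IH => g gf; apply: PP' => e'.
by rewrite inE negb_or => /andP[ne /gf->]; rewrite /upd (negPf ne).
Qed.

(** A condition on edges already labeled comes out of the sum as a factor. *)
Lemma count_ext_and es P P' b f :
  (forall g, (forall e, e \notin es -> g e = f e) -> P g = b && P' g) ->
  count_ext es P f = b%:R * count_ext es P' f.
Proof.
move/eq_count_ext->; case: b; rewrite ?mul1r ?mul0r //.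
by elim: es f => [|e es IH] f //=; rewrite big1.
Qed.

Definition up_ok (g : edge -> label) x y :=
  allowed (g (edge60 x y)) (g (edge120 x y)) (g (edge0 x y)).
Definition down_ok (g : edge -> label) x y :=
  allowed (g (edge0 x y.+1)) (g (edge60 x.+1 y)) (g (edge120 x y)).

Fixpoint row_edges x y k : seq edge :=
  if k is k'.+1 then
    [:: edge60 x.+1 y, edge120 x.+1 y, edge0 x y.+1 & row_edges x.+1 y k']
  else [::].

Fixpoint row_ok g v x y k : bool :=
  if k is k'.+1 then
    (down_ok g x y && up_ok g x.+1 y) && row_ok g v x.+1 y k'
  else g (edge120 x y) == label_of_bit v.

Definition bottom (g : edge -> label) x y k : seq label :=
  [seq g (edge0 j y) | j <- iota x k].

(** Horizontal edges at height [y] get 2y and slanted ones 2y + 1, so levels tell rows apart. *)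
Definition level (e : edge) : nat := (e.1.2 + e.2.2)%N.

Lemma big_label (F : label -> int) : \sum_l F l = F L0 + F L1 + F L10.
Proof.
rewrite (bigD1 L0) // (bigD1 L1) // (bigD1 L10) //= big1 ?addr0 ?addrA //.
by case.
Qed.

(** With both parameters 0 the rhombus vertex has weight 0, and the other vertices are the pairs of
    pieces sharing a 60-edge [s]. *)
Lemma rowop_cons v n F l t :
  rowop (0 : int) 0 v n F (l :: t) =
  \sum_s \sum_m \sum_o
    (allowed o s n && allowed s m l)%:R *
    rowop 0 0 v m (fun r => F (o :: r)) t.
Proof.
by rewrite !big_label /= ?(addr0, subrr); case: n; case: l;
   rewrite /allowed /= ?(mul0r, mul1r, add0r, addr0) // addrC.
Qed.

Lemma level_row_edges x y k (e : edge) : e \in row_edges x y k ->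
  (y.*2 < level e <= y.*2.+2)%N && (x < e.2.1)%N.
Proof.
elim: k x => [|k IH] x //=; rewrite !inE.
by case/or4P => [/eqP->|/eqP->|/eqP->|/IH]; rewrite /level /=; lia.
Qed.

Lemma bottom_upd f e l x y k :
  level e != y.*2 -> bottom (upd f e l) x y k = bottom f x y k.
Proof.
move=> ne; apply: eq_map => j; rewrite /upd; case: (edge0 j y =P e) ne => // <-.
by rewrite /level /= addnn eqxx.
Qed.

Section Row.
Variables (v : bool) (y x0 k0 : nat) (rest : seq edge).
Variables (Psi : (edge -> label) -> bool) (F : seq label -> int).
Hypothesis rest_above : forall e : edge, e \in rest -> (y.*2.+2 < level e)%N.
Hypothesis rest_count : forall g,
  count_ext rest Psi g = F (bottom g x0 y.+1 k0).

(** With [m] sites labeled and [k] to go, the top labels chosen so far become a prefix of the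
    argument of [F]; the region above the row sees only its top string. *)
Lemma count_row k m f : (m + k)%N = k0 ->
  count_ext (row_edges (x0 + m) y k ++ rest)
    (fun g => row_ok g v (x0 + m) y k && Psi g) f =
  rowop 0 0 v (f (edge120 (x0 + m) y))
    (fun o => F (bottom f x0 y.+1 m ++ o)) (bottom f (x0 + m).+1 y k).
Proof.
elim: k m f => [|k IH] m f mk.
  rewrite (@count_ext_and _ _ Psi (f (edge120 (x0 + m) y) == label_of_bit v)).
    rewrite /= rest_count cats0 -mk addn0.
    by case: eqP; rewrite ?mul1r ?mul0r.
  move=> g gf; rewrite /= gf //; apply/negP => /rest_above.
  by rewrite /level /=; lia.
set x := (x0 + m)%N; set Phi := fun g => _.
rewrite [bottom f _ y k.+1]/= rowop_cons.
transitivity (\sum_s \sum_n \sum_o count_ext (row_edges x.+1 y k ++ rest) Phi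
  (upd (upd (upd f (edge60 x.+1 y) s) (edge120 x.+1 y) n) (edge0 x y.+1) o)).
  by [].
apply: eq_bigr => s _; apply: eq_bigr => n _; apply: eq_bigr => o _.
set f' := upd _ _ _.
(* The three edges of the current site have second endpoint of abscissa x + 1; those of later sites
   lie further right. *)
have notin (e : edge) : (level e <= y.*2)%N || (e.2.1 <= x.+1)%N -> (level e <= y.*2.+2)%N ->
    e \notin row_edges x.+1 y k ++ rest.
  rewrite mem_cat negb_or => e1 e2; apply/andP; split; apply/negP.
    by move/level_row_edges; lia.
  by move/rest_above; lia.
have E0 : f' (edge0 x y.+1) = o by rewrite /f' upd_eq.
have E120 : f' (edge120 x.+1 y) = n.
  by rewrite /f' upd_neq ?upd_eq // !xpair_eqE; lia.
have E60 : f' (edge60 x.+1 y) = s.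
  by rewrite /f' 2?upd_neq ?upd_eq // !xpair_eqE; lia.
have El : f' (edge120 x y) = f (edge120 x y).
  by rewrite /f' !upd_neq // !xpair_eqE; lia.
have Eb : f' (edge0 x.+1 y) = f (edge0 x.+1 y).
  by rewrite /f' !upd_neq // !xpair_eqE; lia.
have bot w i : bottom f' w y i = bottom f w y i.
  by rewrite /f' !bottom_upd // /level /=; lia.
have top : bottom f' x0 y.+1 m.+1 = rcons (bottom f x0 y.+1 m) o.
  rewrite /bottom -[m.+1]addn1 iotaD map_cat /= -/x E0 cats1; congr rcons.
  apply/eq_in_map => j; rewrite mem_iota => jx.
  by rewrite /f' !upd_neq // !xpair_eqE; lia.
rewrite (@count_ext_and _ _ (fun g => row_ok g v x.+1 y k && Psi g)
   (allowed o s (f (edge120 x y)) && allowed s n (f (edge0 x.+1 y)))).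
  congr (_ * _); rewrite /x -addnS IH ?addSnnS //.
  rewrite addnS -/x E120 bot.
  by apply: eq_rowop => r _; rewrite top cat_rcons.
move=> g gf; rewrite /Phi /= -!andbA; congr [&& _, _ & _].
  by rewrite /down_ok !gf ?notin /level //= ?E0 ?E60 ?El //; lia.
by rewrite /up_ok !gf ?notin /level //= ?E120 ?E60 ?Eb //; lia.
Qed.

End Row.

(** * Counting triangles and trapezoids row by row *)

Fixpoint tri_edges y k : seq edge :=
  if k is k'.+1 then
    [:: edge60 0 y, edge120 0 y & row_edges 0 y k' ++ tri_edges y.+1 k']
  else [::].

Fixpoint tri_ok g y (vs gs : seq bool) : bool :=
  match vs, gs with
  | v :: vs', b :: gs' =>
    ((g (edge60 0 y) == label_of_bit b) && up_ok g 0 y) &&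
    (row_ok g v 0 y (size vs') && tri_ok g y.+1 vs' gs')
  | _, _ => true
  end.

Fixpoint trap_edges_from c y a : seq edge :=
  if a is x.+1 then
    edge120 x y :: row_edges x y c ++ trap_edges_from c y.+1 x
  else tri_edges y c.

Fixpoint trap_ok g c y (bs vs gs : seq bool) : bool :=
  if bs is b :: bs' then
    (g (edge120 (size bs') y) == label_of_bit b) &&
    (row_ok g (head false vs) (size bs') y c &&
     trap_ok g c y.+1 bs' (behead vs) gs)
  else tri_ok g y vs gs.

Lemma level_tri_edges y k (e : edge) : e \in tri_edges y k -> (y.*2 < level e)%N.
Proof.
elim: k y => [|k IH] y //=; rewrite !inE mem_cat.
by case/or4P => [/eqP->|/eqP->|/level_row_edges|/IH]; rewrite /level /=; lia.
Qed.

Lemma level_trap_edges_from c y a (e : edge) :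
  e \in trap_edges_from c y a -> (y.*2 < level e)%N.
Proof.
elim: a y => [|a IH] y; first exact: level_tri_edges.
rewrite inE mem_cat.
by case/or3P => [/eqP->|/level_row_edges|/IH]; rewrite /level /=; lia.
Qed.

Lemma indicator_cons b gs l o :
  indicator int (b :: gs) (l :: o) =
  (l == label_of_bit b)%:R * indicator int gs o.
Proof. by rewrite /indicator /= eqseq_cons -natrM mulnb. Qed.

Lemma triop_cons v vs b gs l t :
  triop (0 : int) (v :: vs) (indicator int (b :: gs)) (l :: t) =
  \sum_n (allowed (label_of_bit b) n l)%:R *
    rowop 0 0 v n (triop 0 vs (indicator int gs)) t.
Proof.
have E s n : rowop (0 + 0) 0 v n
      (triop (0 + 0) vs (fun r => indicator int (b :: gs) (s :: r))) t =
    (s == label_of_bit b)%:R * rowop 0 0 v n (triop 0 vs (indicator int gs)) t.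
  rewrite addr0 -rowopZ; apply: eq_rowop => r _; rewrite -triopZ.
  by apply: eq_triop => u _; rewrite indicator_cons.
rewrite big_label; case: l; case: b E => E;
  by rewrite /= !E /allowed /= ?(mul0r, mul1r, add0r, addr0).
Qed.

Lemma count_tri y vs gs f : size gs = size vs ->
  count_ext (tri_edges y (size vs)) (fun g => tri_ok g y vs gs) f =
  triop 0 vs (indicator int gs) (bottom f 0 y (size vs)).
Proof.
elim: vs gs y f => [|v vs IH] [|b gs] y f // [sz].
transitivity (\sum_(s : label) \sum_(n : label)
  count_ext (row_edges 0 y (size vs) ++ tri_edges y.+1 (size vs))
   (fun g => ((g (edge60 0 y) == label_of_bit b) && up_ok g 0 y) &&
    (row_ok g v 0 y (size vs) && tri_ok g y.+1 vs gs))
   (upd (upd f (edge60 0 y) s) (edge120 0 y) n)).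
  by [].
have notin (e : edge) : (level e <= y.*2)%N ||
    (e.2.1 == 0) && (level e <= y.*2.+1)%N ->
    e \notin row_edges 0 y (size vs) ++ tri_edges y.+1 (size vs).
  rewrite mem_cat negb_or => e1; apply/andP; split; apply/negP.
    by move/level_row_edges; lia.
  by move/level_tri_edges; lia.
have row s n : count_ext (row_edges 0 y (size vs) ++ tri_edges y.+1 (size vs))
   (fun g => ((g (edge60 0 y) == label_of_bit b) && up_ok g 0 y) &&
    (row_ok g v 0 y (size vs) && tri_ok g y.+1 vs gs))
   (upd (upd f (edge60 0 y) s) (edge120 0 y) n) =
  ((s == label_of_bit b) && allowed s n (f (edge0 0 y)))%:R *
  rowop 0 0 v n (triop 0 vs (indicator int gs)) (bottom f 1 y (size vs)).
  set f' := upd _ _ _.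
  have E120 : f' (edge120 0 y) = n by rewrite /f' upd_eq.
  have E60 : f' (edge60 0 y) = s.
    by rewrite /f' upd_neq ?upd_eq // !xpair_eqE; lia.
  have E0 : f' (edge0 0 y) = f (edge0 0 y).
    by rewrite /f' !upd_neq // !xpair_eqE; lia.
  rewrite (@count_ext_and _ _
     (fun g => row_ok g v 0 y (size vs) && tri_ok g y.+1 vs gs)
     ((s == label_of_bit b) && allowed s n (f (edge0 0 y)))).
    congr (_ * _).
    rewrite (@count_row v y 0 (size vs) _ (fun g => tri_ok g y.+1 vs gs)
      (triop 0 vs (indicator int gs)) _ _ (size vs) 0) //.
    - rewrite E120 /f' !bottom_upd //; rewrite /level /=; lia.
    - by move=> e /level_tri_edges; lia.
    - by move=> g; apply: IH.
  move=> g gf; rewrite /up_ok !gf ?notin /level //= ?E0 ?E60 ?E120 //; lia.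
rewrite [bottom _ _ _ _]/= triop_cons.
rewrite (bigD1 (label_of_bit b)) //= [X in _ + X]big1 ?addr0.
  by apply: eq_bigr => n _; rewrite row eqxx.
by move=> s /negPf sb; apply: big1 => n _; rewrite row sb mul0r.
Qed.

Lemma count_trap c y bs vs gs f :
  size vs = (size bs + c)%N -> size gs = c ->
  count_ext (trap_edges_from c y (size bs)) (fun g => trap_ok g c y bs vs gs) f =
  trapop 0 bs vs (indicator int gs) (bottom f (size bs) y c).
Proof.
elim: bs vs y f => [|b bs IH] vs y f szv szg.
  by rewrite -[c]szv; apply: count_tri; rewrite szg szv.
case: vs szv => [|v vs] //= [szv].
set x := size bs.
transitivity (\sum_(n : label)
  count_ext (row_edges x y c ++ trap_edges_from c y.+1 x)
   (fun g => (g (edge120 x y) == label_of_bit b) &&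
    (row_ok g v x y c && trap_ok g c y.+1 bs vs gs))
   (upd f (edge120 x y) n)).
  by [].
have row n : count_ext (row_edges x y c ++ trap_edges_from c y.+1 x)
   (fun g => (g (edge120 x y) == label_of_bit b) &&
    (row_ok g v x y c && trap_ok g c y.+1 bs vs gs))
   (upd f (edge120 x y) n) = (n == label_of_bit b)%:R *
  rowop 0 0 v n (trapop 0 bs vs (indicator int gs)) (bottom f x.+1 y c).
  rewrite (@count_ext_and _ _
     (fun g => row_ok g v x y c && trap_ok g c y.+1 bs vs gs)
     (n == label_of_bit b)).
    congr (_ * _).
    have := @count_row v y x c _ (fun g => trap_ok g c y.+1 bs vs gs)
      (trapop 0 bs vs (indicator int gs)) _ _ c 0.
    rewrite addn0 => ->; rewrite ?add0n //.
    - rewrite upd_eq [bottom _ x.+1 _ _]bottom_upd //; rewrite /level /=; lia.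
    - by move=> e /level_trap_edges_from; lia.
    - by move=> g; apply: IH.
  move=> g gf; rewrite gf ?upd_eq //; rewrite mem_cat negb_or.
  apply/andP; split; apply/negP.
    by move/level_row_edges; rewrite /level /=; lia.
  by move/level_trap_edges_from; rewrite /level /=; lia.
rewrite (bigD1 (label_of_bit b)) //= [X in _ + X]big1 ?addr0.
  by rewrite row eqxx mul1r.
by move=> n /negPf nb; rewrite row nb mul0r.
Qed.

(** * The South side and the enumeration of all edges *)

Fixpoint floor_edges x k : seq edge :=
  if k is k'.+1 then edge0 x 0 :: floor_edges x.+1 k' else [::].

Fixpoint floor_ok (g : edge -> label) x (ds : seq bool) : bool :=
  if ds is d :: ds' then
    (g (edge0 x 0) == label_of_bit d) && floor_ok g x.+1 ds'
  else true.

Lemma mem_row_edges x y k X Y :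
  [/\ (edge0 X Y \in row_edges x y k) = (Y == y.+1) && (x <= X < x + k)%N,
      (edge60 X Y \in row_edges x y k) = (Y == y) && (x < X <= x + k)%N
    & (edge120 X Y \in row_edges x y k) = (Y == y) && (x < X <= x + k)%N].
Proof.
elim: k x => [|k IH] x /=; first by rewrite !in_nil; split; lia.
have [E0 E60 E120] := IH x.+1.
by rewrite !inE E0 E60 E120 !xpair_eqE; split; lia.
Qed.

Lemma mem_tri_edges y k X Y :
  [/\ (edge0 X Y \in tri_edges y k) = (y < Y)%N && (X + Y < y + k)%N,
      (edge60 X Y \in tri_edges y k) = (y <= Y)%N && (X + Y < y + k)%N
    & (edge120 X Y \in tri_edges y k) = (y <= Y)%N && (X + Y < y + k)%N].
Proof.
elim: k y => [|k IH] y /=; first by rewrite !in_nil; split; lia.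
have [E0 E60 E120] := IH y.+1; have [R0 R60 R120] := mem_row_edges 0 y k X Y.
by rewrite !inE !mem_cat E0 E60 E120 R0 R60 R120 !xpair_eqE; split; lia.
Qed.

Lemma mem_trap_edges_from c y a X Y :
  [/\ (edge0 X Y \in trap_edges_from c y a) =
        (y < Y)%N && (a + y <= X + Y < a + y + c)%N,
      (edge60 X Y \in trap_edges_from c y a) =
        (y <= Y)%N && (a + y <= X + Y < a + y + c)%N
    & (edge120 X Y \in trap_edges_from c y a) =
        (y <= Y)%N && (a + y <= X.+1 + Y <= a + y + c)%N].
Proof.
elim: a y => [|a IH] y.
  by have [E0 E60 E120] := mem_tri_edges y c X Y; rewrite /= E0 E60 E120; split; lia.
have [E0 E60 E120] := IH y.+1; have [R0 R60 R120] := mem_row_edges a y c X Y.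
by rewrite /= !inE !mem_cat E0 E60 E120 R0 R60 R120 !xpair_eqE; split; lia.
Qed.

Lemma mem_floor_edges x k X Y :
  [/\ (edge0 X Y \in floor_edges x k) = (Y == 0) && (x <= X < x + k)%N,
      (edge60 X Y \in floor_edges x k) = false
    & (edge120 X Y \in floor_edges x k) = false].
Proof.
elim: k x => [|k IH] x /=; first by rewrite !in_nil; split; lia.
have [E0 E60 E120] := IH x.+1.
by rewrite !inE E0 E60 E120 !xpair_eqE; split; lia.
Qed.

Definition all_edges a c := floor_edges a c ++ trap_edges_from c 0 a.

Definition is_unit_edge (e : edge) :=
  exists X Y, [\/ e = edge0 X Y, e = edge60 X Y | e = edge120 X Y].

Lemma all_edges_unit a c e : e \in all_edges a c -> is_unit_edge e.
Proof.
have u0 X Y : is_unit_edge (edge0 X Y) by exists X, Y; apply: Or31.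
have u60 X Y : is_unit_edge (edge60 X Y) by exists X, Y; apply: Or32.
have u120 X Y : is_unit_edge (edge120 X Y) by exists X, Y; apply: Or33.
have row x y k : e \in row_edges x y k -> is_unit_edge e.
  elim: k x => [|k IH] x //=; rewrite !inE.
  by case/or4P => [/eqP->|/eqP->|/eqP->|/IH].
have tri y k : e \in tri_edges y k -> is_unit_edge e.
  elim: k y => [|k IH] y //=; rewrite !inE mem_cat.
  by case/or4P => [/eqP->|/eqP->|/row|/IH].
rewrite mem_cat => /orP[].
  by elim: c a => [|k IH] x //=; rewrite inE => /orP[/eqP->|/IH].
elim: a 0%N => [|a IH] y; first exact: tri.
by rewrite inE mem_cat => /or3P[/eqP->|/row|/IH].
Qed.

Lemma mem_all_edges a c : all_edges a c =i trap_edges a c.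
Proof.
move=> e; apply/idP/idP => [ae|].
  have [X [Y kind]] := all_edges_unit ae.
  have [F0 F60 F120] := mem_floor_edges a c X Y.
  have [T0 T60 T120] := mem_trap_edges_from c 0 a X Y.
  rewrite mem_filter mem_cat [X in _ || X]mem_cat.
  have r_mem n : (n <= a + c)%N -> n \in iota 0 (a + c).+1.
    by rewrite mem_iota add0n ltnS.
  case: kind ae => ->; rewrite mem_cat ?F0 ?F60 ?F120 ?T0 ?T60 ?T120 => ae;
    (apply/andP; split; first by rewrite /in_trap /=; lia).
  - by apply/or3P; apply: Or31; apply: (allpairs_f edge0); apply: r_mem; lia.
  - by apply/or3P; apply: Or32; apply: (allpairs_f edge60); apply: r_mem; lia.
  - by apply/or3P; apply: Or33; apply: (allpairs_f edge120); apply: r_mem; lia.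
rewrite mem_filter /in_trap mem_cat [X in _ || X]mem_cat => /andP[].
move=> in12 /or3P[] /allpairsP[[X Y] [_ _ /= E]]; move: in12; rewrite {}E mem_cat /=.
- have [-> _ _] := mem_floor_edges a c X Y.
  have [-> _ _] := mem_trap_edges_from c 0 a X Y; lia.
- have [_ -> _] := mem_floor_edges a c X Y.
  have [_ -> _] := mem_trap_edges_from c 0 a X Y; lia.
- have [_ _ ->] := mem_floor_edges a c X Y.
  have [_ _ ->] := mem_trap_edges_from c 0 a X Y; lia.
Qed.

Lemma all_edges_uniq a c : uniq (all_edges a c).
Proof.
have row x y k : uniq (row_edges x y k).
  elim: k x => [|k IH] x //=; rewrite IH !inE !negb_or !xpair_eqE.
  have [_ R60 _] := mem_row_edges x.+1 y k x.+1 y.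
  have [R0 _ _] := mem_row_edges x.+1 y k x y.+1.
  have [_ _ R120] := mem_row_edges x.+1 y k x.+1 y.
  by rewrite R60 R0 R120; lia.
have rowX x y k es : (forall e : edge, e \in es -> (y.*2.+2 < level e)%N) ->
    uniq es -> uniq (row_edges x y k ++ es).
  move=> above ues; rewrite cat_uniq row ues andbT; apply/hasPn => e /above ab.
  by apply/negP => /level_row_edges; lia.
have tri y k : uniq (tri_edges y k).
  elim: k y => [|k IH] y //=; rewrite rowX // => [|e /level_tri_edges]; last lia.
  rewrite !inE !negb_or !mem_cat !xpair_eqE.
  have [_ R60 R120] := mem_row_edges 0 y k 0 y.
  have [_ T60 T120] := mem_tri_edges y.+1 k 0 y.
  by rewrite R60 R120 T60 T120; lia.
have trap y b : uniq (trap_edges_from c y b).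
  elim: b y => [|b IH] y //=; rewrite rowX // => [|e /level_trap_edges_from]; last lia.
  rewrite mem_cat andbT.
  have [_ _ R120] := mem_row_edges b y c b y.
  have [_ _ T120] := mem_trap_edges_from c y.+1 b b y.
  by rewrite R120 T120; lia.
rewrite cat_uniq trap andbT; apply/andP; split.
  elim: {1}c a => [|k IH] x //=; rewrite IH andbT.
  by have [-> _ _] := mem_floor_edges x.+1 k x 0; lia.
apply/hasPn => e /level_trap_edges_from e0; apply/negP => ef.
suff : level e = 0%N by lia.
elim: {1}c a ef => [|k IH] x //=; rewrite inE => /orP[/eqP->|/IH] //.
Qed.

(** Listing the edges in the order [es] identifies labelings with tuples of labels, over which
    [count_ext] is an iterated sum. *)
Lemma sum_labelings a c es (P : (edge -> label) -> bool) :
  (forall f g, f =1 g -> P f = P g) -> uniq es -> es =i trap_edges a c ->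
  #|[set f : labeling a c | P (edge_label f)]|%:R = count_ext es P (fun=> L0).
Proof.
move=> extP ues es_trap.
pose assign (f0 : edge -> label) (es : seq edge) (t : seq label) (e : edge) :=
  if e \in es then nth L0 t (index e es) else f0 e.
have count f0 : count_ext es P f0 =
    \sum_(t : (size es).-tuple label) (P (assign f0 es t))%:R.
  elim: es ues f0 {es_trap} => [|e es IH] /= ues f0.
    rewrite (bigD1 [tuple]) //= big1 ?addr0 => [|t]; last by rewrite tuple0.
    by rewrite (extP f0 (assign f0 [::] [::])).
  case/andP: ues => ne ues.
  under eq_bigr do rewrite IH //.
  rewrite pair_big /=.
  rewrite (reindex (fun p : label * (size es).-tuple label => [tuple of p.1 :: p.2])) /=.
    apply: eq_bigr => -[l t] _ /=; congr (nat_of_bool _)%:R; apply: extP => e'.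
    rewrite /assign inE /= /upd eq_sym; case: (e =P e') => [<-|] //=.
    by rewrite (negPf ne).
  exists (fun t => (thead t, [tuple of behead t])) => [[l t]|t] _.
    by congr pair; apply: val_inj.
  by rewrite /= -tuple_eta.
rewrite count.
pose tup (f : labeling a c) : (size es).-tuple label :=
  map_tuple (edge_label f) (in_tuple es).
pose lab (t : (size es).-tuple label) : labeling a c :=
  [ffun e => nth L0 t (index (val e) es)].
have labE t e : e \in es -> edge_label (lab t) e = nth L0 t (index e es).
  move=> ees; have etrap : e \in trap_edges a c by rewrite -es_trap.
  by rewrite /edge_label insubT /= ffunE.
have labK : cancel lab tup.
  move=> t; apply: val_inj; apply: (@eq_from_nth _ L0) => /=.
    by rewrite size_map size_tuple.
  move=> i; rewrite size_map => lti.
  by rewrite (nth_map (edge0 0 0)) // labE ?mem_nth // index_uniq.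
have tupK : cancel tup lab.
  move=> f; apply/ffunP => e; have ees : val e \in es by rewrite es_trap ssvalP.
  rewrite ffunE /= (nth_map (edge0 0 0)) ?index_mem // nth_index //.
  by rewrite /edge_label valK.
rewrite -sum1_card natr_sum big_mkcond /= (reindex lab) /=.
  apply: eq_bigr => t _; rewrite inE.
  rewrite (extP _ (assign (fun=> L0) es t)); first by case: (P _).
  (* Off the trapezoid both sides take the dummy value [L0]. *)
  move=> e; rewrite /assign; case: ifP => [/labE//|/negbT ne].
  by rewrite /edge_label insubF // -es_trap; apply/negbTE.
by exists tup => t _; [exact: labK | exact: tupK].
Qed.

Fixpoint set_floor (f : edge -> label) x (ds : seq bool) : edge -> label :=
  if ds is d :: ds' then
    set_floor (upd f (edge0 x 0) (label_of_bit d)) x.+1 ds'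
  else f.

Lemma set_floor_lt f x ds X Y : (X < x)%N ->
  set_floor f x ds (edge0 X Y) = f (edge0 X Y).
Proof.
elim: ds f x => [|d ds IH] f x //= lt; rewrite IH; last lia.
by rewrite upd_neq // !xpair_eqE; lia.
Qed.

Lemma bottom_set_floor f x ds : bottom (set_floor f x ds) x 0 (size ds) = bit_labels ds.
Proof.
elim: ds f x => [|d ds IH] f x //.
rewrite [bit_labels _]/= -[RHS]/(_ :: bit_labels ds) -(IH (upd f (edge0 x 0) (label_of_bit d)) x.+1).
by rewrite /bottom [LHS]/= set_floor_lt // upd_eq.
Qed.

(** The South labels are forced, so the sum over them has a single nonzero term. *)
Lemma count_floor x ds rest Psi f :
  (forall e : edge, e \in rest -> (0 < level e)%N) ->
  count_ext (floor_edges x (size ds) ++ rest)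
    (fun g => floor_ok g x ds && Psi g) f =
  count_ext rest Psi (set_floor f x ds).
Proof.
move=> above; elim: ds x f => [|d ds IH] x f //.
transitivity (\sum_(l : label) count_ext (floor_edges x.+1 (size ds) ++ rest)
  (fun g => (g (edge0 x 0) == label_of_bit d) && floor_ok g x.+1 ds && Psi g)
  (upd f (edge0 x 0) l)); first by [].
have step l : count_ext (floor_edges x.+1 (size ds) ++ rest)
  (fun g => (g (edge0 x 0) == label_of_bit d) && floor_ok g x.+1 ds && Psi g)
  (upd f (edge0 x 0) l) = (l == label_of_bit d)%:R *
  count_ext rest Psi (set_floor (upd f (edge0 x 0) l) x.+1 ds).
  rewrite -IH; apply: count_ext_and => g gf; rewrite gf ?upd_eq ?andbA //.
  rewrite mem_cat negb_or; have [-> _ _] := mem_floor_edges x.+1 (size ds) x 0.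
  rewrite ltnn andbF /=; apply/negP => /above.
  by rewrite /level.
rewrite (bigD1 (label_of_bit d)) //= big1 ?addr0 => [|l /negPf ld].
  by rewrite step eqxx mul1r.
by rewrite step ld mul0r.
Qed.

(** * Recursive conditions compared with the definition of a puzzle *)

Lemma row_okP g v x y k : row_ok g v x y k <->
  (forall X, (x <= X < x + k)%N -> down_ok g X y /\ up_ok g X.+1 y) /\
  g (edge120 (x + k) y) = label_of_bit v.
Proof.
elim: k x => [|k IH] x /=.
  rewrite addn0; split=> [/eqP E|[_ /eqP//]]; split=> // X; lia.
rewrite addnS; split=> [/andP[/andP[dn up] /IH[ok E]]|[ok E]].
  split=> // X ltX; have [->//|ne] := eqVneq X x; apply: ok; lia.
have [-> ->] : down_ok g x y /\ up_ok g x.+1 y by apply: ok; lia.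
by apply/IH; split=> // X ltX; apply: ok; lia.
Qed.

Lemma tri_okP g y (vs gs : seq bool) : size gs = size vs ->
  tri_ok g y vs gs <->
  [/\ forall Y, (y <= Y < y + size vs)%N ->
        g (edge60 0 Y) = label_of_bit (nth false gs (Y - y)),
      forall Y, (y <= Y < y + size vs)%N ->
        g (edge120 (y + size vs - Y.+1) Y) = label_of_bit (nth false vs (Y - y)),
      forall X Y, (y <= Y)%N -> (X + Y < y + size vs)%N -> up_ok g X Y
    & forall X Y, (y <= Y)%N -> (X + Y.+1 < y + size vs)%N -> down_ok g X Y].
Proof.
elim: vs gs y => [|v vs IH] [|b gs] y //=.
  by move=> _; split=> // _; split=> *; lia.
case=> sz.
have shift Y : (y < Y)%N -> (Y - y = (Y - y.+1).+1)%N by lia.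
split=> [/andP[/andP[/eqP E60 up0] /andP[/row_okP[row E120]]]|[O60 O120 up dn]].
  rewrite add0n in E120.
  case/(IH _ _ sz) => O60 O120 up dn; split.
  - move=> Y yY; have [->|ne] := eqVneq Y y; first by rewrite subnn.
    by rewrite shift /= ?O60 //; lia.
  - move=> Y yY; have [->|ne] := eqVneq Y y.
      by rewrite subnn (_ : (_ - _)%N = size vs) //; lia.
    by rewrite shift /= -?O120 -?addSnnS //; lia.
  - move=> X Y yY ltXY; have [->|ne] := eqVneq Y y; last by apply: up; lia.
    by case: X ltXY => // X ltXY; have [] : down_ok g X y /\ up_ok g X.+1 y
      by apply: row; lia.
  - move=> X Y yY ltXY; have [E|ne] := eqVneq Y y; last by apply: dn; lia.
    by rewrite E; have [] : down_ok g X y /\ up_ok g X.+1 y by apply: row; lia.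
apply/andP; split.
  by rewrite up ?O60 ?subnn ?eqxx //; lia.
apply/andP; split.
  apply/row_okP; split=> [X ltX|].
    by split; [apply: dn | apply: up]; lia.
  have /= := O120 y; rewrite subnn (_ : (_ - _)%N = 0 + size vs)%N; last lia.
  by apply; lia.
apply/(IH _ _ sz); split.
- by move=> Y yY; rewrite O60 ?shift //; lia.
- move=> Y yY; have := O120 Y; rewrite shift /= -?addSnnS; last lia.
  by apply; lia.
- by move=> X Y yY ltXY; apply: up; lia.
- by move=> X Y yY ltXY; apply: dn; lia.
Qed.

Lemma trap_okP g c y (bs vs gs : seq bool) :
  size gs = c -> size vs = (size bs + c)%N ->
  trap_ok g c y bs vs gs <->
  [/\ forall Y, (y <= Y < y + size bs)%N ->
        g (edge120 (y + size bs - Y.+1) Y) = label_of_bit (nth false bs (Y - y)),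
      forall Y, (y + size bs <= Y < y + size vs)%N ->
        g (edge60 0 Y) = label_of_bit (nth false gs (Y - (y + size bs))),
      forall Y, (y <= Y < y + size vs)%N ->
        g (edge120 (y + size vs - Y.+1) Y) = label_of_bit (nth false vs (Y - y)),
      forall X Y, (y <= Y)%N -> (y + size bs <= X + Y < y + size vs)%N ->
        up_ok g X Y
    & forall X Y, (y <= Y)%N -> (y + size bs <= X + Y.+1 < y + size vs)%N ->
        down_ok g X Y].
Proof.
move=> szg; elim: bs vs y => [|b bs IH] vs y szv.
  rewrite /= addn0; have := @tri_okP g y vs gs; rewrite szg szv => /(_ erefl) ->.
  split=> [[O60 O120 up dn]|[_ O60 O120 up dn]]; split=> //.
  - by move=> Y; lia.
  - by move=> X Y yY /andP[_]; exact: up.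
  - by move=> X Y yY /andP[_]; exact: dn.
  - by move=> X Y yY lt; apply: up; lia.
  - by move=> X Y yY lt; apply: dn; lia.
case: vs szv => [|v vs] //= [szv].
have shift Y : (y < Y)%N -> (Y - y = (Y - y.+1).+1)%N by lia.
split=> [/andP[/eqP Eb /andP[/row_okP[row Ev]]]|[Ob Og Ov up dn]].
  case/(IH _ _ szv) => Ob Og Ov up dn; split.
  - move=> Y yY; have [->|ne] := eqVneq Y y.
      by rewrite subnn (_ : (_ - _)%N = size bs) //; lia.
    by rewrite shift /= -?Ob -?addSnnS //; lia.
  - by move=> Y yY; rewrite Og ?addSnnS //; lia.
  - move=> Y yY; have [->|ne] := eqVneq Y y.
      by rewrite subnn (_ : (_ - _)%N = (size bs + c)%N) //; lia.
    by rewrite shift /= -?Ov -?addSnnS //; lia.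
  - move=> X Y yY ltXY; have [E|ne] := eqVneq Y y; last by apply: up; lia.
    rewrite E; case: X ltXY => [|X] ltXY; first lia.
    by have [] : down_ok g X y /\ up_ok g X.+1 y by apply: row; lia.
  - move=> X Y yY ltXY; have [E|ne] := eqVneq Y y; last by apply: dn; lia.
    by rewrite E; have [] : down_ok g X y /\ up_ok g X.+1 y by apply: row; lia.
apply/andP; split.
  have /= := Ob y; rewrite subnn (_ : (_ - _)%N = size bs) => [->//|]; lia.
apply/andP; split.
  apply/row_okP; split=> [X ltX|].
    by split; [apply: dn | apply: up]; lia.
  have /= := Ov y; rewrite subnn (_ : (_ - _)%N = size bs + c)%N; last lia.
  by apply; lia.
apply/(IH _ _ szv); split.
- move=> Y yY; have := Ob Y; rewrite shift /= -?addSnnS; last lia.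
  by apply; lia.
- by move=> Y yY; rewrite Og -?addSnnS //; lia.
- move=> Y yY; have := Ov Y; rewrite shift /= -?addSnnS; last lia.
  by apply; lia.
- by move=> X Y yY ltXY; apply: up; lia.
- by move=> X Y yY ltXY; apply: dn; lia.
Qed.

Lemma floor_okP g x ds : floor_ok g x ds <->
  forall i, (i < size ds)%N -> g (edge0 (x + i) 0) = label_of_bit (nth false ds i).
Proof.
elim: ds x => [|d ds IH] x /=; first by split.
split=> [/andP[/eqP E /IH ok] [|i] lti|ok]; first by rewrite addn0.
  by rewrite addnS -addSn; apply: ok.
rewrite -[x in edge0 x 0]addn0 ok // eqxx; apply/IH => i lti.
by rewrite addSn -addnS ok.
Qed.

Section Puzzle.
Variables (a c : nat) (beta : a.-tuple bool) (gamma delta : c.-tuple bool).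
Variable nu : (a + c).-tuple bool.

(** Clockwise, South is read from right to left and NE from top to bottom, against the order of the
    rows; hence the two reversals. *)
Definition puzzle_ok g :=
  floor_ok g a (rev delta) && trap_ok g c 0 beta (rev nu) gamma.

Lemma is_trap_puzzleE (f : labeling a c) :
  is_trap_puzzle beta gamma nu delta f = puzzle_ok (edge_label f).
Proof.
have sg : size gamma = c by rewrite size_tuple.
have sv : size (rev nu) = (size beta + c)%N by rewrite size_rev !size_tuple.
have sb := size_tuple beta.
have sn := size_tuple nu.
rewrite /is_trap_puzzle /boundary_agrees /up_triangles_allowed
  /down_triangles_allowed /puzzle_ok.
set g := edge_label f.
apply/idP/idP.
  case/and3P => /and4P[/forallP B /forallP G /forallP N /forallP D].
  move=> /forallP up /forallP dn; apply/andP; split.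
    apply/floor_okP => i; rewrite size_rev size_tuple => lti.
    have lt' : (c - i.+1 < c)%N by lia.
    have /eqP := D (Ordinal lt'); rewrite (tnth_nth false) /=.
    rewrite nth_rev ?size_tuple // => <-.
    by congr (g (edge0 _ 0)); lia.
  apply/(trap_okP _ _ sg sv); rewrite sv !sb !add0n; split.
  - move=> Y ltY; have lt' : (Y < a)%N by lia.
    by have /eqP := B (Ordinal lt'); rewrite (tnth_nth false) subn0.
  - move=> Y ltY; have lt' : (Y - a < c)%N by lia.
    have /eqP := G (Ordinal lt'); rewrite (tnth_nth false) /= => <-.
    by congr (g (edge60 0 _)); lia.
  - move=> Y ltY; have lt' : (a + c - Y.+1 < a + c)%N by lia.
    have /eqP := N (Ordinal lt'); rewrite (tnth_nth false) /= subn0.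
    rewrite nth_rev sn; last lia.
    by move=> <-; congr (g (edge120 _ _)); lia.
  - move=> X Y _ ltXY.
    have ltX : (X < (a + c).+1)%N by lia.
    have ltY : (Y < (a + c).+1)%N by lia.
    have /forallP/(_ (Ordinal ltY))/implyP := up (Ordinal ltX); apply.
    by rewrite /in_trap /=; lia.
  - move=> X Y _ ltXY.
    have ltX : (X < (a + c).+1)%N by lia.
    have ltY : (Y < (a + c).+1)%N by lia.
    have /forallP/(_ (Ordinal ltY))/implyP := dn (Ordinal ltX); apply.
    by rewrite /in_trap /=; lia.
case/andP => /floor_okP; rewrite size_rev size_tuple => D.
case/(trap_okP _ _ sg sv); rewrite sv !sb !add0n => B G N up dn.
apply/and3P; split; first apply/and4P; first split.
- apply/forallP => i; rewrite (tnth_nth false); apply/eqP.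
  by have := B i; rewrite subn0; apply; rewrite ltn_ord.
- apply/forallP => i; rewrite (tnth_nth false); apply/eqP.
  have := G (a + i)%N; rewrite addKn; apply.
  by have := ltn_ord i; lia.
- apply/forallP => i; rewrite (tnth_nth false); apply/eqP.
  have lti := ltn_ord i.
  have := N (a + c - i.+1)%N; rewrite subn0 nth_rev sn; last lia.
  move=> E; have {E} := E _.
  rewrite (_ : (a + c - (a + c - i.+1).+1)%N = i); last lia.
  by apply; lia.
- apply/forallP => i; rewrite (tnth_nth false); apply/eqP.
  have lti := ltn_ord i.
  have := D (c - i.+1)%N; rewrite nth_rev size_tuple; last lia.
  rewrite (_ : (c - (c - i.+1).+1)%N = i); last lia.
  rewrite (_ : (a + (c - i.+1) = a + c - i.+1)%N); last lia.
  by apply; lia.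
- apply/forallP => x; apply/forallP => y; apply/implyP.
  by rewrite /in_trap /= => in_t; apply: up; lia.
- apply/forallP => x; apply/forallP => y; apply/implyP.
  by rewrite /in_trap /= => in_t; apply: dn; lia.
Qed.

Lemma eq_puzzle_ok g g' : g =1 g' -> puzzle_ok g = puzzle_ok g'.
Proof.
move=> gg; have row v x y k : row_ok g v x y k = row_ok g' v x y k.
  by elim: k x => [|k IH] x /=; rewrite /down_ok /up_ok !gg ?IH.
have tri y vs gs : tri_ok g y vs gs = tri_ok g' y vs gs.
  by elim: vs gs y => [|v vs IH] [|b gs] y //=; rewrite /up_ok !gg row IH.
congr (_ && _).
  by elim: (rev delta) a => [|d ds IH] x //=; rewrite gg IH.
elim: (val beta) (rev nu) 0%N => [|b bs IH] vs y /=; first exact: tri.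
by rewrite gg row IH.
Qed.

Lemma Trap_trapop : (Trap beta gamma nu delta)%:R =
  trapop (0 : int) beta (rev nu) (indicator int gamma) (bit_labels (rev delta)).
Proof.
rewrite /Trap; under eq_finset do rewrite is_trap_puzzleE.
rewrite (sum_labelings eq_puzzle_ok (all_edges_uniq a c) (@mem_all_edges a c)).
have sd : size (rev delta) = c by rewrite size_rev size_tuple.
have sb : size beta = a by rewrite size_tuple.
rewrite /all_edges -{1}sd count_floor; last by move=> e /level_trap_edges_from; lia.
rewrite -{1}sb count_trap ?size_rev ?size_tuple //.
by have := bottom_set_floor (fun=> L0) a (rev delta); rewrite sd => ->.
Qed.

End Puzzle.

(** * Triangular puzzles *)

Section Rotation.
Variable c : nat.
Implicit Types gamma nu delta : c.-tuple bool.

Definition Tri gamma nu delta : nat :=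
  @Trap 0 c [tuple] gamma nu delta.

Lemma tri_puzzleP gamma nu delta (f : labeling 0 c) :
  let g := edge_label f in
  @is_trap_puzzle 0 c [tuple] gamma nu delta f <->
  [/\ forall i, (i < c)%N -> g (edge0 (c - i.+1) 0) = label_of_bit (nth false delta i),
      forall i, (i < c)%N -> g (edge60 0 i) = label_of_bit (nth false gamma i),
      forall i, (i < c)%N -> g (edge120 i (c - i.+1)) = label_of_bit (nth false nu i),
      forall X Y, (X + Y < c)%N -> up_ok g X Y
    & forall X Y, (X + Y.+1 < c)%N -> down_ok g X Y].
Proof.
move=> g; rewrite is_trap_puzzleE -/g /puzzle_ok.
have sg : size gamma = c by rewrite size_tuple.
have sn : size nu = c by rewrite size_tuple.
have sd : size delta = c by rewrite size_tuple.
have sv : size (rev nu) = (size (@nil bool) + c)%N by rewrite size_rev.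
have rv i : (i < c)%N -> (c - (c - i.+1).+1)%N = i by lia.
split=> [/andP[/floor_okP D /(trap_okP _ _ sg sv)[_ G N up dn]]|[D G N up dn]].
  rewrite /= ?size_rev ?sn ?sd ?add0n in D G N up dn.
  split=> [i lti|i lti|i lti|X Y lt|X Y lt].
  - have := D (c - i.+1)%N; rewrite nth_rev sd ?rv //; last lia.
    by rewrite add0n; apply; lia.
  - by rewrite G // subn0.
  - have := N (c - i.+1)%N; rewrite subn0 nth_rev sn ?rv //; last lia.
    by apply; lia.
  - exact: up.
  - exact: dn.
apply/andP; split.
  apply/floor_okP => i; rewrite size_rev sd => lti.
  rewrite nth_rev ?sd // -D; last lia.
  by rewrite rv.
apply/(trap_okP _ _ sg sv); rewrite /= size_rev sn !add0n.
split=> [Y|Y lti|Y lti|X Y _ lt|X Y _ lt].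
- by lia.
- by rewrite subn0 G.
- rewrite subn0 nth_rev sn // -N; last lia.
  by rewrite rv.
- exact: up.
- exact: dn.
Qed.

(** Clockwise turn by 120 degrees. The coordinates shared by the endpoints reveal the direction of
    the edge; the base abscissa of a 120-edge is that of its second endpoint. *)
Definition rotate_edge (e : edge) : edge :=
  if e.1.2 == e.2.2 then edge60 e.1.2 (c - (e.1.1 + e.1.2).+1)
  else if e.1.1 == e.2.1 then edge120 e.1.2 (c - (e.1.1 + e.1.2).+1)
  else edge0 e.1.2 (c - (e.2.1 + e.1.2).+1).

Lemma rotate_edge0 X Y : rotate_edge (edge0 X Y) = edge60 Y (c - (X + Y).+1).
Proof. by rewrite /rotate_edge /= eqxx. Qed.

Lemma rotate_edge60 X Y : rotate_edge (edge60 X Y) = edge120 Y (c - (X + Y).+1).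
Proof. by rewrite /rotate_edge /= eqxx ifF //; lia. Qed.

Lemma rotate_edge120 X Y : rotate_edge (edge120 X Y) = edge0 Y (c - (X + Y).+1).
Proof. by rewrite /rotate_edge /= !ifF //; lia. Qed.

Lemma mem_tri_trap_edges X Y :
  [/\ (edge0 X Y \in trap_edges 0 c) = (X + Y < c)%N,
      (edge60 X Y \in trap_edges 0 c) = (X + Y < c)%N
    & (edge120 X Y \in trap_edges 0 c) = (X + Y < c)%N].
Proof.
rewrite -!mem_all_edges !mem_cat.
have [F0 F60 F120] := mem_floor_edges 0 c X Y.
have [T0 T60 T120] := mem_trap_edges_from c 0 0 X Y.
by rewrite F0 F60 F120 T0 T60 T120; split; lia.
Qed.

Definition rotate (f : labeling 0 c) : labeling 0 c :=
  [ffun e => edge_label f (rotate_edge (val e))].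

Lemma edge_label_rotate f e : e \in trap_edges 0 c ->
  edge_label (rotate f) e = edge_label f (rotate_edge e).
Proof. by move=> et; rewrite {1}/edge_label insubT /= ffunE. Qed.

Lemma edge_label_rotateE f X Y : (X + Y < c)%N ->
  [/\ edge_label (rotate f) (edge0 X Y) = edge_label f (edge60 Y (c - (X + Y).+1)),
      edge_label (rotate f) (edge60 X Y) = edge_label f (edge120 Y (c - (X + Y).+1))
    & edge_label (rotate f) (edge120 X Y) = edge_label f (edge0 Y (c - (X + Y).+1))].
Proof.
move=> lt; have [M0 M60 M120] := mem_tri_trap_edges X Y.
by rewrite !edge_label_rotate ?M0 ?M60 ?M120 // rotate_edge0 rotate_edge60 rotate_edge120.
Qed.

Lemma rotate_inj : injective rotate.
Proof.
move=> f f' E; apply/ffunP => e.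
have vE (h : labeling 0 c) : h e = edge_label h (val e) by rewrite /edge_label valK.
have same X Y : (X + Y < c)%N ->
    [/\ edge_label f (edge0 X Y) = edge_label f' (edge0 X Y),
        edge_label f (edge60 X Y) = edge_label f' (edge60 X Y)
      & edge_label f (edge120 X Y) = edge_label f' (edge120 X Y)].
  move=> lt; pose Z := (c - (X + Y).+1)%N.
  have lt' : (Z + X < c)%N by rewrite /Z; lia.
  have [A0 A60 A120] := edge_label_rotateE f lt'.
  have [B0 B60 B120] := edge_label_rotateE f' lt'.
  have Y_def : (c - (Z + X).+1)%N = Y by rewrite /Z; lia.
  rewrite Y_def in A0 A60 A120 B0 B60 B120.
  by rewrite -A120 -B120 -A0 -B0 -A60 -B60 E.
have ae : val e \in all_edges 0 c by rewrite mem_all_edges ssvalP.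
have [X [Y kind]] := all_edges_unit ae.
have [M0 M60 M120] := mem_tri_trap_edges X Y.
rewrite !vE; rewrite mem_all_edges in ae.
by case: kind ae => ->; rewrite ?M0 ?M60 ?M120 => /same[].
Qed.

Lemma allowed_rot l1 l2 l3 : allowed l2 l3 l1 = allowed l1 l2 l3.
Proof. by case: l1; case: l2; case: l3. Qed.

(** Rotation is injective on labelings and preserves the pieces, which are closed under cyclic
    rotation. *)
Lemma Tri_rotate_le gamma nu delta : (Tri gamma nu delta <= Tri nu delta gamma)%N.
Proof.
rewrite /Tri /Trap -(card_imset _ rotate_inj); apply/subset_leq_card/subsetP => f'.
case/imsetP => f; rewrite inE => /tri_puzzleP[D G N up dn] ->.
rewrite inE; apply/tri_puzzleP; split=> [i lti|i lti|i lti|X Y lt|X Y lt].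
- have [|-> _ _] := @edge_label_rotateE f (c - i.+1) 0; first lia.
  by rewrite -G //; congr (edge_label f (edge60 0 _)); lia.
- have [|_ -> _] := @edge_label_rotateE f 0 i; first lia.
  by rewrite -N.
- have [|_ _ ->] := @edge_label_rotateE f i (c - i.+1); first lia.
  by rewrite -D //; congr (edge_label f (edge0 _ _)); lia.
- have [E0 E60 E120] := edge_label_rotateE f lt.
  by rewrite /up_ok E0 E60 E120 allowed_rot; apply: up; lia.
have lt1 : (X.+1 + Y < c)%N by lia.
have lt2 : (X + Y < c)%N by lia.
have [E0 _ _] := edge_label_rotateE f lt.
have [_ E60 _] := edge_label_rotateE f lt1.
have [_ _ E120] := edge_label_rotateE f lt2.
have := dn Y (c - (X + Y.+1).+1)%N; rewrite /down_ok E0 E60 E120.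
rewrite (_ : (c - (X + Y).+1)%N = (c - (X + Y.+1).+1).+1); last lia.
rewrite addSnnS -allowed_rot => ok; apply: ok; lia.
Qed.

Lemma Tri_rotate gamma nu delta : Tri gamma nu delta = Tri nu delta gamma.
Proof.
apply/eqP; rewrite eqn_leq Tri_rotate_le /=.
(* Three rotations return to the start, so the inequalities close up. *)
exact: leq_trans (Tri_rotate_le _ _ _) (Tri_rotate_le _ _ _).
Qed.

End Rotation.

(** * From commutation and rotation to the symmetry of trapezoids *)

Section Symmetry.
Variable c : nat.
Implicit Types gamma nu delta : c.-tuple bool.

Definition rev_tuple (t : c.-tuple bool) : c.-tuple bool := [tuple of rev t].

Lemma sorted_size k : (k <= c)%N -> size (sorted_string k (c - k)) == c.
Proof. by move=> le_kc; rewrite size_cat !size_nseq subnKC. Qed.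

Definition sorted_tuple k (le_kc : (k <= c)%N) : c.-tuple bool :=
  Tuple (sorted_size le_kc).

Lemma triop_sorted_tuple k (le_kc : (k <= c)%N) (t : c.-tuple bool) F :
  count_mem true t = k ->
  triop (0 : int) (rev t) F (bit_labels (sorted_tuple le_kc)) = F (bit_labels (rev t)).
Proof.
by move=> tk; apply: triop_sorted; rewrite ?count_rev // size_rev size_tuple subnKC.
Qed.

(** A triangle with NE side [delta] produces the South string from the sorted one; by commutation
    the sorted string may cross the trapezoid first, and [g] is the string between the two
    regions. *)
Lemma Trap_factor a (beta : a.-tuple bool) (nu : (a + c).-tuple bool)
    gamma delta k (le_kc : (k <= c)%N) : count_mem true delta = k ->
  (Trap beta gamma nu delta)%:R =
  \sum_(g : c.-tuple bool)
     (Trap beta g nu (rev_tuple (sorted_tuple le_kc)))%:R *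
     (Tri gamma delta (rev_tuple g))%:R :> int.
Proof.
move=> dk; rewrite Trap_trapop -(triop_sorted_tuple le_kc _ dk).
have szb : size (rev nu) = (size beta + c)%N by rewrite size_rev !size_tuple.
have szd : size (rev delta) = (size (@nil bool) + c)%N.
  by rewrite size_rev size_tuple.
rewrite [LHS](trapop_comm (bs1 := [::]) _ _ szd szb) trapop_expand.
by apply: eq_bigr => g _; rewrite !Trap_trapop /= !revK.
Qed.

(** For a = 0 the first factor of [Trap_factor] has a sorted side, so only the reversal of [nu]
    survives in the sum. *)
Lemma Tri_swap23 gamma nu delta : count_mem true nu = count_mem true delta ->
  Tri gamma nu delta = Tri gamma delta nu.
Proof.
move=> nd; have le_dc : (count_mem true delta <= c)%N.
  by rewrite -[c in (_ <= c)%N](size_tuple delta) count_size.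
apply/eqP; rewrite -(eqr_nat int); apply/eqP.
rewrite [LHS](@Trap_factor 0 [tuple] nu gamma delta _ le_dc) //.
have first g : (@Trap 0 c [tuple] g nu (rev_tuple (sorted_tuple le_dc)))%:R =
    (rev_tuple nu == g)%:R :> int.
  by rewrite Trap_trapop /= revK triop_sorted_tuple // indicator_bit_labels.
rewrite (bigD1 (rev_tuple nu)) //= big1 ?addr0 => [|g gn].
  rewrite first eqxx mul1r; congr (Tri _ _ _)%:R.
  by apply: val_inj; rewrite /= revK.
by rewrite first eq_sym (negPf gn) mul0r.
Qed.

Lemma Tri_swap12 gamma delta rho : count_mem true gamma = count_mem true delta ->
  Tri gamma delta rho = Tri delta gamma rho.
Proof.
by move=> gd; rewrite -Tri_rotate Tri_swap23 // Tri_rotate.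
Qed.

(** Equal numbers of ones give [gamma] and [delta] the same sorted string, hence the same
    trapezoidal coefficients; the triangular ones agree by [Tri_swap12]. *)
Lemma Trap_swap a (beta : a.-tuple bool) (nu : (a + c).-tuple bool) gamma delta :
  count_mem true gamma = count_mem true delta ->
  Trap beta gamma nu delta = Trap beta delta nu gamma.
Proof.
move=> gd; have le_dc : (count_mem true delta <= c)%N.
  by rewrite -[c in (_ <= c)%N](size_tuple delta) count_size.
apply/eqP; rewrite -(eqr_nat int); apply/eqP.
rewrite (Trap_factor _ _ _ le_dc) // [RHS](Trap_factor _ _ _ le_dc) //.
by apply: eq_bigr => g _; rewrite Tri_swap12.
Qed.

End Symmetry.

Local Close Scope ring_scope.

Theorem theorem2 (a0 a1 c0 c1 : nat)
    (beta : (a0 + a1).-tuple bool) (gamma delta : (c0 + c1).-tuple bool)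
    (nu : ((a0 + a1) + (c0 + c1)).-tuple bool)
    (hbeta : beta \in binary_strings (a0 + a1) a1)
    (hgamma : gamma \in binary_strings (c0 + c1) c1)
    (hdelta : delta \in binary_strings (c0 + c1) c1)
    (hnu : nu \in binary_strings ((a0 + a1) + (c0 + c1)) (a1 + c1)) :
  Trap beta gamma nu delta = Trap beta delta nu gamma.
Proof.
move: hgamma hdelta; rewrite !inE => /eqP hgamma /eqP hdelta.
by apply: Trap_swap; rewrite hgamma hdelta.
Qed.
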